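(* There exist a compact Riemannian manifold $M$ and a vector field $X_0\in\mathfrak{X}^\infty_2(M)$ such that the map $X\mapsto h_{\mathrm{top}}(\phi^X)$ is not lower semicontinuous on $\mathfrak{X}^\infty_2(M)$ (with the $C^\infty$ topology) at $X_0$.
   Context: $\mathfrak{X}^\infty_2(M)$ is the set of $C^\infty$ vector fields on $M$ which generate partially hyperbolic flows with center bundle of dimension $2$; $\phi^X=(\phi^X_t)_{t\in\mathbb{R}}$ is the flow generated by $X$, and $h_{\mathrm{top}}(\phi^X)=h_{\mathrm{top}}(\phi^X_1)$ is its topological entropy. A flow $\phi_t$ on $M$ is partially hyperbolic if there are a $D\phi_t$-invariant splitting $TM=E^s\oplus E^c\oplus E^u$ and constants $C>0$, $0<\lambda<1$ such that $\|D\phi_t(x)|_{E^s_x}\|\le C\lambda^t$ and $\|(D\phi_t(x)|_{E^u_x})^{-1}\|\le C\lambda^t$ for all $x\in M$, $t\ge0$, and the decompositions $(E^s\oplus E^c)\oplus E^u$ and $E^s\oplus(E^c\oplus E^u)$ are dominated; here an invariant splitting $TM=E\oplus F$ is dominated if there are $C>0$, $0<\lambda<1$ with $\|D\phi_t(x)|_{E_x}\|\,/\,\|D\phi_{-t}(\phi_t(x))|_{F_{\phi_t(x)}}\|^{-1}\le C\lambda^t$ for all $x\in M$, $t\ge0$. One of $E^s$, $E^u$ may be trivial, but not both. The center dimension is $\dim E^c$. *)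

(* Defs.v *)
From HB Require Import structures.
From mathcomp Require Import all_boot all_order all_algebra.
From mathcomp Require Import all_classical all_reals all_analysis.

Set Implicit Arguments.
Unset Strict Implicit.
Unset Printing Implicit Defensive.

Import Order.TTheory GRing.Theory Num.Theory.
Import numFieldNormedType.Exports.

Local Open Scope classical_set_scope.
Local Open Scope ring_scope.

Section smooth_maps.
Context (R : realType) (m : nat) (V : normedModType R).
Implicit Types (f : 'rV[R]_m -> V) (U : set 'rV[R]_m).

Definition partial (i : 'I_m) f : 'rV[R]_m -> V :=
  fun p => 'D_(delta_mx 0 i) f p.

Definition iter_partial (s : seq 'I_m) f : 'rV[R]_m -> V :=
  foldr partial f s.

(* C^infinity on an open set U: every iterated partial derivative exists and
   is (Frechet) differentiable, hence continuous, on U. Only the germs of f at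
   the points of U matter. *)
Definition smooth_on U f :=
  forall (s : seq 'I_m) p, U p -> differentiable (iter_partial s f) p.

End smooth_maps.

(* The values of chart_map outside chart_dom, and those of chart_inv outside
   the image of chart_dom, are irrelevant. *)
Record chart (R : realType) (m : nat) (M : topologicalType) := Chart {
  chart_dom : set M ;
  chart_map : M -> 'rV[R]_m ;
  chart_inv : 'rV[R]_m -> M ;
  open_chart_dom : open chart_dom ;
  open_chart_img : open (chart_map @` chart_dom) ;
  chart_mapK : forall x, chart_dom x -> chart_inv (chart_map x) = x ;
  chart_map_continuous : {within chart_dom, continuous chart_map} ;
  chart_inv_continuous :
    {within chart_map @` chart_dom, continuous chart_inv} }.

Definition chart_img (R : realType) (m : nat) (M : topologicalType)
  (c : chart R m M) : set 'rV[R]_m := chart_map c @` chart_dom c.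

(* Smooth manifolds without boundary, of dimension m. Each point x carries a
   preferred chart chart_at x of the atlas, in which T_x M is read as R^m. *)
Record manifold (R : realType) (m : nat) := Manifold {
  points :> topologicalType ;
  atlas : set (chart R m points) ;
  chart_at : points -> chart R m points ;
  manifold_hausdorff : hausdorff_space points ;
  manifold_second_countable : @second_countable points ;
  atlas_chart_at : forall x, atlas (chart_at x) ;
  mem_chart_at : forall x, chart_dom (chart_at x) x ;
  atlas_compatible : forall c c', atlas c -> atlas c' ->
    smooth_on (chart_map c @` (chart_dom c `&` chart_dom c'))
              (chart_map c' \o chart_inv c) }.

Section tangent.
Context (R : realType) (m : nat) (M : manifold R m).

(* Tangent vectors are row vectors and linear maps act on the right:
   for v in T_x M, v *m tangent_to_chart c x gives its coordinates in c. *)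
Definition tangent_to_chart (c : chart R m M) (x : M) : 'M[R]_m :=
  'J (chart_map c \o chart_inv (chart_at x)) (chart_map (chart_at x) x).

Definition tangent_of_chart (c : chart R m M) (x : M) : 'M[R]_m :=
  'J (chart_map (chart_at x) \o chart_inv c) (chart_map c x).

(* Df(x) : T_x M -> T_(f x) M *)
Definition mderiv (f : M -> M) (x : M) : 'M[R]_m :=
  'J (chart_map (chart_at (f x)) \o f \o chart_inv (chart_at x))
     (chart_map (chart_at x) x).

Definition field_in_chart (X : M -> 'rV[R]_m) (c : chart R m M)
    (p : 'rV[R]_m) : 'rV[R]_m :=
  X (chart_inv c p) *m tangent_to_chart c (chart_inv c p).

Definition form_in_chart (G : M -> 'M[R]_m) (c : chart R m M)
    (p : 'rV[R]_m) : 'M[R]_m :=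
  let J := tangent_of_chart c (chart_inv c p) in
  J *m G (chart_inv c p) *m J^T.

End tangent.

Record riemannian_metric (R : realType) (m : nat) (M : manifold R m) :=
  RiemannianMetric {
  gram :> M -> 'M[R]_m ;
  gram_sym : forall x, (gram x)^T = gram x ;
  gram_posdef : forall x (v : 'rV[R]_m), v != 0 ->
    0 < (v *m gram x *m v^T) 0 0 ;
  gram_smooth : forall c, atlas c ->
    smooth_on (chart_img c) (form_in_chart gram c) }.

Record vfield (R : realType) (m : nat) (M : manifold R m) := VField {
  vfield_fun :> M -> 'rV[R]_m ;
  vfield_smooth : forall c, atlas c ->
    smooth_on (chart_img c) (field_in_chart vfield_fun c) }.

HB.instance Definition _ (R : realType) (m : nat) (M : manifold R m) :=
  gen_eqMixin (vfield M).
HB.instance Definition _ (R : realType) (m : nat) (M : manifold R m) :=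
  gen_choiceMixin (vfield M).

(* The C^infinity topology: uniform convergence, on compact subsets of the
   charts of the atlas, of all the partial derivatives of the coordinates. *)
Section cinfty_topology.
Context (R : realType) (m : nat) (M : manifold R m).

Definition cinfty_ball (X : vfield M) (c : chart R m M) (K : set 'rV[R]_m)
    (s : seq 'I_m) (e : R) : set (vfield M) :=
  [set Y : vfield M | forall p, K p ->
    `|iter_partial s (field_in_chart Y c) p
      - iter_partial s (field_in_chart X c) p| < e].

Definition cinfty_subbase : set (set (vfield M)) :=
  [set B | exists X c K s e,
    [/\ atlas c, compact K, K `<=` chart_img c, 0 < e
      & B = cinfty_ball X c K s e]].

HB.instance Definition _ :=
  isSubBaseTopological.Build (vfield M) cinfty_subbase id.

End cinfty_topology.

Section flows.
Context (R : realType) (m : nat) (M : manifold R m).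

Definition is_flow_of (X : M -> 'rV[R]_m) (phi : R -> M -> M) :=
  [/\ forall x, phi 0 x = x,
      forall s t x, phi (s + t) x = phi s (phi t x),
      forall x : M, continuous (phi ^~ x)
    & forall (x : M) (t : R), is_derive t (1 : R)
        (fun s : R => chart_map (chart_at (phi t x)) (phi s x)) (X (phi t x))].

(* The flow generated by X; it exists and is unique when M is compact and X
   is smooth. *)
Definition flow (X : M -> 'rV[R]_m) : R -> M -> M :=
  xget ((fun _ x => x) : R -> M -> M) [set phi : R -> M -> M | is_flow_of X phi].

End flows.

Section partial_hyperbolicity.
Context (R : realType) (m : nat) (M : manifold R m) (g : riemannian_metric M).

Definition tnorm (x : M) (v : 'rV[R]_m) : R :=
  Num.sqrt ((v *m g x *m v^T) 0 0).

(* Operator norm of the restriction to (the row space of) E <= T_x M of a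
   linear map A : T_x M -> T_y M; it is 0 when E = 0, as sup set0 = 0. *)
Definition opnorm (x y : M) (A E : 'M[R]_m) : R :=
  sup [set tnorm y (v *m A) | v in
         [set v : 'rV[R]_m | (v <= E)%MS /\ tnorm x v = 1]].

Definition dominated (phi : R -> M -> M) (E F : M -> 'M[R]_m) :=
  exists C lambda : R, [/\ 0 < C, 0 < lambda < 1 &
    forall x t, 0 <= t ->
      opnorm x (phi t x) (mderiv (phi t) x) (E x)
      / (opnorm (phi t x) x (mderiv (phi (- t)) (phi t x)) (F (phi t x)))^-1
      <= C * lambda `^ t].

Definition subbundle (d : nat) (E : M -> 'M[R]_m) :=
  forall x, \rank (E x) = d.

Definition invariant (phi : R -> M -> M) (E : M -> 'M[R]_m) :=
  forall t x, (E x *m mderiv (phi t) x :=: E (phi t x))%MS.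

(* Partial hyperbolicity with center bundle of dimension dc. The inverse of
   A|E is the restriction of A^-1 to the image E *m A of E. *)
Definition partially_hyperbolic (dc : nat) (phi : R -> M -> M) :=
  exists (ds du : nat) (Es Ec Eu : M -> 'M[R]_m),
  [/\ [/\ subbundle ds Es, subbundle dc Ec, subbundle du Eu
        & (0 < ds + du)%N],
      forall x, mxdirect (Es x + Ec x + Eu x)%MS
                /\ (Es x + Ec x + Eu x :=: 1%:M)%MS,
      [/\ invariant phi Es, invariant phi Ec & invariant phi Eu],
      exists C lambda : R, [/\ 0 < C, 0 < lambda < 1 &
        forall x t, 0 <= t ->
          opnorm x (phi t x) (mderiv (phi t) x) (Es x) <= C * lambda `^ t /\
          opnorm (phi t x) x (invmx (mderiv (phi t) x))
            (Eu x *m mderiv (phi t) x) <= C * lambda `^ t]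
    & dominated phi (fun x => (Es x + Ec x)%MS) Eu /\
      dominated phi Es (fun x => (Ec x + Eu x)%MS)].

Definition ph_fields (dc : nat) : set (vfield M) :=
  [set X : vfield M | partially_hyperbolic dc (flow X)].

End partial_hyperbolicity.

(* Topological entropy, by open covers (Adler-Konheim-McAndrew). *)
Section entropy.
Context (R : realType) (T : topologicalType).
Implicit Type U : set (set T).

Definition open_cover U := U `<=` open /\ \bigcup_(A in U) A = [set: T].

Definition cover_number U : R :=
  inf [set n%:R | n in [set n : nat | exists A : 'I_n -> set T,
    (forall i, U (A i)) /\ \bigcup_i A i = [set: T]]].

Definition cover_join (f : T -> T) (n : nat) U : set (set T) :=
  [set B | exists A : 'I_n -> set T,
    (forall i, U (A i)) /\ B = \bigcap_(i in [set: 'I_n]) (iter i f @^-1` A i)].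

(* The limit exists, by subadditivity, when T is compact. *)
Definition cover_entropy (f : T -> T) U : \bar R :=
  limn_esup (fun n => (ln (cover_number (cover_join f n U)) / n%:R)%:E).

Definition htop (f : T -> T) : \bar R :=
  ereal_sup [set cover_entropy f U | U in open_cover].

End entropy.

Definition htop_flow (R : realType) (m : nat) (M : manifold R m)
  (X : vfield M) : \bar R := htop R (flow X 1).

Definition lower_semicontinuous_at (R : realType) (T : topologicalType)
    (A : set T) (f : T -> \bar R) (x : T) :=
  forall a : R, (a%:E < f x)%E ->
    \forall y \near within A (nbhs x), (a%:E < f y)%E.

(* Main.v *)
(* The example lives on M = R^4 / Gamma, the product of the suspension of a
   hyperbolic automorphism of the 2-torus with a circle. The coordinates are
   (x, y, s, t): x and y are the unstable and the stable direction, s is the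
   suspension time and t the angle on the circle; the metric
   e^(2s) dx^2 + e^(-2s) dy^2 + ds^2 + dt^2 is Gamma-invariant.

   The field X_eta = tau (2 + cos t) d/ds + eta d/dt expands x and contracts y,
   while its derivative is only a shear of linear growth on the plane (s, t), so
   it is partially hyperbolic with a center of dimension 2. The flow of X_0
   preserves the circle t = 0, where the suspension runs at speed 3 tau, whence
   h_top(X_0) >= 3 tau. For eta <> 0 the angle rotates, the speed averages to
   2 tau up to an error which is bounded in time, and h_top(X_eta) <= 2 tau.
   Since X_eta tends to X_0, lower semicontinuity fails at X_0. *)
From HB Require Import structures.
Require Import Defs.
From mathcomp Require Import all_boot all_order all_algebra generic_quotient.
From mathcomp Require Import all_classical all_reals all_analysis.
From mathcomp Require Import ring lra.

Set Implicit Arguments.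
Unset Strict Implicit.
Unset Printing Implicit Defensive.

Import Order.TTheory GRing.Theory Num.Theory.
Import numFieldNormedType.Exports.

Local Open Scope classical_set_scope.
Local Open Scope ring_scope.

(** * Smooth maps *)

(** The choices are made so that everything stays explicit. The lattice is Z[sqrt 3], embedded by
    its two real places, and the automorphism is multiplication by the unit 2 + sqrt 3: in these
    coordinates each deck transformation is diagonal followed by a translation. The speed depends on
    the angle alone, so the flow has a closed form; as [flow] is only chosen among the solutions of
    its equations, uniqueness has to be proved as well.

    Since 2 + cos 0 = 3 is an integer, the flow of X_0 for an integer time n maps an unstable leaf
    over t = 0 to itself, multiplying it by e^(3 tau n); this produces the separated points. For
    fixed eta <> 0 the error in s is at most 2 tau / |eta|. It blows up as eta tends to 0, but it
    enters only the constant in front of e^(2 tau n), and the same bound keeps nearby angles from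
    drifting apart along s. *)

Lemma near_eq_is_diff (K : numFieldType) (V W : normedModType K)
    (f g : V -> W) (x : V) (dg : V -> W) :
  (\forall y \near x, f y = g y) -> is_diff x g dg -> is_diff x f dg.
Proof.
move=> fg [dgx <-]; have /diff_locallyP[cdg Eg] := dgx.
suff Ef : f \o shift x = cst (f x) + 'd g x +o_ 0 id.
  have Ed : 'd f x = 'd g x :> (V -> W) by exact: diff_unique.
  by split => //; apply/diff_locallyP; rewrite Ed.
apply/eqaddoP => _/posnumP[e].
have fgx : f x = g x by exact: (nbhs_singleton fg).
have fg' : \forall y \near 0, f (y + x) = g (y + x).
  by move: fg; rewrite (near_shift 0 x) subr0.
move/eqaddoP : Eg => /(_ e%:num (gt0 e)) Eg.
apply: filterS2 fg' Eg => y Ey /=; rewrite /GRing.add /= /GRing.opp/=.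
by rewrite fgx -Ey.
Qed.

Lemma near_eq_iter_partial (R : realType) (m : nat) (V : normedModType R)
    (s : seq 'I_m) (f g : 'rV[R]_m -> V) (p : 'rV[R]_m) :
  (\forall q \near p, f q = g q) ->
  \forall q \near p, iter_partial s f q = iter_partial s g q.
Proof.
move=> fg; elim: s => //= i s; move/near_join; apply: filterS => q.
exact: near_eq_derive.
Qed.

(** Iterated partial derivatives depend only on germs. Objects read in a chart agree only locally
    with a global formula, and this reduces their smoothness to that of the formula. *)
Lemma smooth_on_near (R : realType) (m : nat) (V : normedModType R)
    (U : set 'rV[R]_m) (f : 'rV[R]_m -> V) :
  (forall p, U p -> exists2 g, smooth_on setT g & \forall q \near p, f q = g q) ->
  smooth_on U f.
Proof.
move=> h s p /h[g /(_ s p I) dg /(near_eq_iter_partial s) fg].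
by have [] := near_eq_is_diff fg (differentiableP dg).
Qed.

Lemma iter_partialD (R : realType) (m : nat) (V : normedModType R)
    (f g : 'rV[R]_m -> V) (s : seq 'I_m) :
  smooth_on setT f -> smooth_on setT g ->
  iter_partial s (f \+ g) = iter_partial s f \+ iter_partial s g.
Proof.
move=> sf sg; elim: s => //= i s ->; apply/funext => p; rewrite /partial.
by rewrite deriveD//; apply: diff_derivable; [exact: sf|exact: sg].
Qed.

Lemma smooth_onD (R : realType) (m : nat) (V : normedModType R)
    (f g : 'rV[R]_m -> V) :
  smooth_on setT f -> smooth_on setT g -> smooth_on setT (f \+ g).
Proof.
move=> sf sg s p _; rewrite iter_partialD//.
by apply: differentiableD; [exact: sf|exact: sg].
Qed.

Lemma iter_partial_cst (R : realType) (m : nat) (V : normedModType R)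
    (c : V) (s : seq 'I_m) :
  iter_partial s (fun _ : 'rV[R]_m => c) = fun=> if s is [::] then c else 0.
Proof.
elim: s => //= i s ->; apply/funext => p; rewrite /partial.
exact: derive_cst.
Qed.

Lemma smooth_on_cst (R : realType) (m : nat) (V : normedModType R) (c : V) :
  smooth_on setT (fun _ : 'rV[R]_m => c).
Proof. by move=> s p _; rewrite iter_partial_cst; exact: differentiable_cst. Qed.

Lemma is_diff_coord (R : realType) (m : nat) (i : 'I_m) (p : 'rV[R]_m) :
  is_diff p (fun q : 'rV[R]_m => q 0 i) (fun q => q 0 i).
Proof.
have @f : {linear 'rV[R]_m -> R}.
  by exists (fun N : 'rV[R]_m => N 0 i); do 2![eexists]; do ?[constructor];
     rewrite ?mxE// => ? *; rewrite ?mxE//; move=> ?; rewrite !mxE.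
rewrite (_ : (fun _ => _) = f) //; split.
  exact/linear_differentiable/coord_continuous.
exact/diff_lin/coord_continuous.
Qed.

Lemma is_diff_coord_comp (R : realType) (m : nat) (V : normedModType R)
    (i : 'I_m) (G : R -> R) (a : R) (v : V) (p : 'rV[R]_m) :
  is_derive (p 0 i) (1 : R) G a ->
  is_diff p (fun q : 'rV[R]_m => G (q 0 i) *: v)
            (fun h => h 0 i *: (a *: v)).
Proof.
move=> [Gd <-]; have dG : differentiable G (p 0 i) by exact/derivable1_diffP.
have [dc dcE] := is_diff_coord i p.
have dGc : differentiable (G \o (fun q : 'rV[R]_m => q 0 i)) p.
  exact: differentiable_comp.
split; first exact: (differentiableZl v dGc).
rewrite (diffZl v dGc); apply/funext => h.
by rewrite (diff_comp dc dG)/= dcE deriv1E//= derive1E scalerA.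
Qed.

(** [G] lists a function with its successive derivatives. A partial derivative along [i] moves one
    step down the list, and any other one kills the vector, so the shape [G n (p 0 i) *: w] is
    stable. *)
Lemma smooth_on_coord_comp (R : realType) (m : nat) (V : normedModType R)
    (i : 'I_m) (G : nat -> R -> R) (v : V) :
  (forall n x, is_derive x (1 : R) (G n) (G n.+1 x)) ->
  smooth_on setT (fun p : 'rV[R]_m => G 0%N (p 0 i) *: v).
Proof.
move=> hG s p _; suff [n [w ->]] : exists n w,
    iter_partial s (fun p : 'rV[R]_m => G 0%N (p 0 i) *: v)
    = fun p => G n (p 0 i) *: w.
  by have [] := is_diff_coord_comp w (hG n (p 0 i)).
elim: s => [|j s [n [w /= ->]]]; first by exists 0%N, v.
exists n.+1, ((j == i)%:R *: w); apply/funext => q; rewrite /partial.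
have [dq dqE] := is_diff_coord_comp w (hG n (q 0 i)).
by rewrite deriveE// dqE mxE eqxx/= scalerA mulrC -scalerA eq_sym.
Qed.

Lemma jacobianE (R : realType) (m n : nat) (f : 'rV[R]_m -> 'rV[R]_n)
    (p : 'rV[R]_m) (A : 'M[R]_(m, n)) :
  is_diff p f (fun v => v *m A) -> 'J f p = A.
Proof.
by move=> [_ dE]; apply/row_matrixP => i; rewrite !rowE mul_rV_lin1 dE.
Qed.

Lemma derivative0_locally_constant (R : realType) (f : R -> R) (a d : R) :
  (forall t, `|t - a| < d -> is_derive t (1 : R) f 0) ->
  forall t, `|t - a| < d -> f t = f a.
Proof.
move=> h t; rewrite ltr_norml => /andP[ta1 ta2].
have {}h u : - d < u - a -> u - a < d -> is_derive u (1 : R) f 0.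
  by move=> u1 u2; apply: h; rewrite ltr_norml u1.
have [ta|ta|->//] := ltgtP t a.
- have [|c|c _] := @MVT R f (cst 0) t a ta.
  + by move=> u; rewrite in_itv/= => /andP[tu ua]; apply: h; lra.
  + apply: derivable_within_continuous => u; rewrite in_itv/= => /andP[tu ua].
    by have [||//] := h u; lra.
  + by rewrite mul0r => /eqP; rewrite subr_eq0 => /eqP.
- have [|c|c _] := @MVT R f (cst 0) a t ta.
  + by move=> u; rewrite in_itv/= => /andP[tu ua]; apply: h; lra.
  + apply: derivable_within_continuous => u; rewrite in_itv/= => /andP[tu ua].
    by have [||//] := h u; lra.
  + by rewrite mul0r => /eqP; rewrite subr_eq0 => /eqP.
Qed.

(** * Coordinates on R^4 *)

Local Notation cx := (@Ordinal 4 0 isT).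
Local Notation cy := (@Ordinal 4 1 isT).
Local Notation cs := (@Ordinal 4 2 isT).
Local Notation ct := (@Ordinal 4 3 isT).

Section coordinates.
Context (R : realType).
Implicit Types (p q : 'rV[R]_4).

Definition vec4 (a b c d : R) : 'rV[R]_4 := \row_(i < 4) [:: a; b; c; d]`_i.

Lemma vec4x a b c d : vec4 a b c d 0 cx = a. Proof. by rewrite mxE. Qed.
Lemma vec4y a b c d : vec4 a b c d 0 cy = b. Proof. by rewrite mxE. Qed.
Lemma vec4s a b c d : vec4 a b c d 0 cs = c. Proof. by rewrite mxE. Qed.
Lemma vec4t a b c d : vec4 a b c d 0 ct = d. Proof. by rewrite mxE. Qed.
Definition vec4E := (vec4x, vec4y, vec4s, vec4t).

Lemma forall_ord4 (P : 'I_4 -> Prop) :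
  P cx -> P cy -> P cs -> P ct -> forall i, P i.
Proof.
move=> h0 h1 h2 h3 [[|[|[|[|//]]]] /= hi].
- by rewrite (_ : Ordinal hi = cx)//; exact/val_inj.
- by rewrite (_ : Ordinal hi = cy)//; exact/val_inj.
- by rewrite (_ : Ordinal hi = cs)//; exact/val_inj.
- by rewrite (_ : Ordinal hi = ct)//; exact/val_inj.
Qed.

Lemma vec4P p q : p 0 cx = q 0 cx -> p 0 cy = q 0 cy -> p 0 cs = q 0 cs ->
  p 0 ct = q 0 ct -> p = q.
Proof. by move=> *; apply/rowP; exact: forall_ord4. Qed.

Lemma vec4_eta p : p = vec4 (p 0 cx) (p 0 cy) (p 0 cs) (p 0 ct).
Proof. by apply: vec4P; rewrite vec4E. Qed.

Lemma ball4P p q e : ball p e q <->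
  [/\ `|p 0 cx - q 0 cx| < e, `|p 0 cy - q 0 cy| < e,
      `|p 0 cs - q 0 cs| < e & `|p 0 ct - q 0 ct| < e].
Proof.
split=> [[_ h]|[h0 h1 h2 h3]]; first by split; apply: h.
split; first exact: le_lt_trans h0.
by move=> i; rewrite ord1; apply: forall_ord4.
Qed.

Lemma sum_ord4 (V : nmodType) (F : 'I_4 -> V) :
  \sum_(i < 4) F i = F cx + F cy + F cs + F ct.
Proof.
rewrite !big_ord_recl big_ord0 addr0 !addrA.
by congr (F _ + F _ + F _ + F _); exact/val_inj.
Qed.

Lemma vec4_sum a b c d : vec4 a b c d =
  a *: delta_mx 0 cx + b *: delta_mx 0 cy + c *: delta_mx 0 cs
  + d *: delta_mx 0 ct.
Proof. by apply: vec4P; rewrite vec4E !mxE/= !mulr0 ?mulr1 ?addr0 ?add0r. Qed.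

End coordinates.

(** * The lattice Z[sqrt 3] and its unit 2 + sqrt 3 *)

Section lattice.
Context (R : realType).

Definition sqrt3 : R := Num.sqrt 3.
(** The logarithm of a unit of Z[sqrt 3] whose conjugate 2 - sqrt 3 is its inverse: multiplication
    by the unit expands one real place and contracts the other by the same factor. *)
Definition tau : R := ln (2 + sqrt3).

Lemma sqrt3_sq : sqrt3 * sqrt3 = 3.
Proof. by rewrite -expr2 sqr_sqrtr. Qed.

Lemma sqrt3_bounds : 1 < sqrt3 < 2.
Proof.
have w0 : 0 <= sqrt3 by exact: sqrtr_ge0.
by have := sqrt3_sq => h; apply/andP; split; nra.
Qed.

Lemma expR_tau : expR tau = 2 + sqrt3.
Proof. by rewrite lnK// posrE; have := sqrt3_bounds; lra. Qed.

Lemma expR_Ntau : expR (- tau) = 2 - sqrt3.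
Proof.
rewrite expRN expR_tau; have /andP[w1 w2] := sqrt3_bounds.
apply: (mulfI (_ : 2 + sqrt3 != 0)); first by rewrite gt_eqF//; lra.
by rewrite divff ?gt_eqF//; have := sqrt3_sq; lra.
Qed.

Lemma tau_ge_half : 1 / 2 <= tau.
Proof.
(* Equivalent to 2 - sqrt 3 <= e^(-1/2), which follows from e^(-1/2) >= 1 - 1/2. *)
rewrite -ler_expR expR_tau -[expR _]invrK -expRN invf_ple ?posrE ?expR_gt0//; last first.
  by have := sqrt3_bounds; lra.
apply: le_trans (expR_ge1Dx _).
rewrite -expR_tau -expRN expR_Ntau; have := sqrt3_bounds; have := sqrt3_sq; nra.
Qed.

Lemma tau_gt0 : 0 < tau.
Proof. by have := tau_ge_half; lra. Qed.

(* The ring Z[sqrt 3], embedded in R^2 by its two real places. *)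
Definition lat (u v : R) := exists a b : int,
  u = a%:~R + b%:~R * sqrt3 /\ v = a%:~R - b%:~R * sqrt3.

Lemma lat0 : lat 0 0.
Proof. by exists 0, 0; rewrite mulr0z; split; ring. Qed.

Lemma latD u v u' v' : lat u v -> lat u' v' -> lat (u + u') (v + v').
Proof.
move=> [a [b [-> ->]]] [a' [b' [-> ->]]]; exists (a + a'), (b + b').
by rewrite !intrD; split; ring.
Qed.

Lemma latN u v : lat u v -> lat (- u) (- v).
Proof.
by move=> [a [b [-> ->]]]; exists (- a), (- b); rewrite !intrN; split; ring.
Qed.

(** Powers of a unit preserve the ring. The induction over the integers needs one step for the unit
    ([hp]) and one for its inverse ([hm]). *)
Lemma lat_expR k u v : lat u v ->
  lat (expR (k%:~R * tau) * u) (expR (- (k%:~R * tau)) * v).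
Proof.
have w2 := sqrt3_sq.
have hp u' v' : lat u' v' -> lat ((2 + sqrt3) * u') ((2 - sqrt3) * v').
  move=> [a [b [-> ->]]]; exists (2 * a + 3 * b), (a + 2 * b).
  rewrite !intrD !intrM; have wb : b%:~R * (sqrt3 * sqrt3) = b%:~R * 3 by rewrite w2.
  by split; lra.
have hm u' v' : lat u' v' -> lat ((2 - sqrt3) * u') ((2 + sqrt3) * v').
  move=> [a [b [-> ->]]]; exists (2 * a - 3 * b), (2 * b - a).
  rewrite !intrB !intrM; have wb : b%:~R * (sqrt3 * sqrt3) = b%:~R * 3 by rewrite w2.
  by split; lra.
move=> uv; elim/int_rect: k => [|n ih|n ih].
- by rewrite mul0r oppr0 expR0 !mul1r.
- rewrite (_ : _ * tau = tau + n%:Z%:~R * tau); last first.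
    by rewrite -addn1 PoszD intrD; ring.
  rewrite opprD !expRD expR_tau expR_Ntau -!mulrA.
  exact: hp.
- rewrite (_ : _ * tau = - tau + (- n%:Z)%:~R * tau); last first.
    by rewrite -addn1 PoszD opprD intrD; ring.
  rewrite opprD opprK !expRD expR_tau expR_Ntau -!mulrA.
  exact: hm.
Qed.

End lattice.

(** * The quotient manifold *)

Section differentials.
Context (R : realType).

Lemma is_diff_coord_real (i : 'I_4) (G : R -> R) (a : R) (p : 'rV[R]_4) :
  is_derive (p 0 i) (1 : R) G a ->
  is_diff p (fun q => G (q 0 i)) (fun h => a * h 0 i).
Proof.
move=> /(@is_diff_coord_comp R 4 R i G a (1 : R) p); rewrite /GRing.scale/=.
have -> : (fun q : 'rV[R]_4 => G (q 0 i) * 1) = (fun q => G (q 0 i)).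
  by apply/funext => q; rewrite mulr1.
have -> // : (fun h : 'rV[R]_4 => h 0 i * (a * 1)) = (fun h => a * h 0 i).
by apply/funext => q; rewrite mulr1 mulrC.
Qed.

Lemma is_diffZl (V W : normedModType R) (f df : V -> R) (w : W) (p : V) :
  is_diff p f df -> is_diff p (fun q => f q *: w) (fun h => df h *: w).
Proof.
by move=> [d <-]; split; [exact: differentiableZl|exact: diffZl].
Qed.

Lemma is_diff_vec4 (V : normedModType R) (a b c d da db dc dd : V -> R) (p : V) :
  is_diff p a da -> is_diff p b db -> is_diff p c dc -> is_diff p d dd ->
  is_diff p (fun q => vec4 (a q) (b q) (c q) (d q))
            (fun h => vec4 (da h) (db h) (dc h) (dd h)).
Proof.
move=> ha hb hc hd.
have E (a' b' c' d' : V -> R) : (fun q => vec4 (a' q) (b' q) (c' q) (d' q)) =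
    (fun q => a' q *: delta_mx 0 cx) + (fun q => b' q *: delta_mx 0 cy) +
    (fun q => c' q *: delta_mx 0 cs) + (fun q => d' q *: delta_mx 0 ct).
  by apply/funext => q; rewrite vec4_sum.
rewrite !E.
exact: (is_diffD (is_diffD (is_diffD (is_diffZl _ ha) (is_diffZl _ hb))
  (is_diffZl _ hc)) (is_diffZl _ hd)).
Qed.

(* Acting on row vectors, [jac k 0] is the differential of a deck transformation
   and [jac 0 h] that of the flow, where [h] is the shear. *)
Definition jac (k h : R) : 'M[R]_4 := \matrix_(i < 4)
  [:: vec4 (expR k) 0 0 0; vec4 0 (expR (- k)) 0 0; vec4 0 0 1 0;
      vec4 0 0 h 1]`_i.

Lemma mul_jac k h (v : 'rV[R]_4) : v *m jac k h =
  vec4 (v 0 cx * expR k) (v 0 cy * expR (- k)) (v 0 cs + h * v 0 ct) (v 0 ct).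
Proof.
by apply: vec4P; rewrite !mxE sum_ord4 !mxE/= ?mulr0 ?mulr1 ?addr0 ?add0r// mulrC.
Qed.

Lemma jacM k h k' h' : jac k h *m jac k' h' = jac (k + k') (h + h').
Proof.
apply/row_matrixP => i; rewrite !rowE mulmxA !mul_jac !vec4E opprD !expRD.
by congr vec4; ring.
Qed.

Lemma jac0 : jac 0 0 = 1%:M.
Proof.
apply/row_matrixP => i; rewrite !rowE mulmx1 mul_jac.
by rewrite oppr0 expR0 !mulr1 mul0r addr0 -vec4_eta.
Qed.

Lemma jac_unit k h : jac k h \in unitmx.
Proof.
suff /mulmx1_unit[] : jac k h *m jac (- k) (- h) = 1%:M by [].
by rewrite jacM !subrr jac0.
Qed.

Lemma invmx_jac k h : invmx (jac k h) = jac (- k) (- h).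
Proof.
have E : jac k h *m jac (- k) (- h) = 1%:M by rewrite jacM !subrr jac0.
by rewrite -[LHS]mulmx1 -E mulmxA mulVmx ?jac_unit// mul1mx.
Qed.

End differentials.

(** * The deck group Gamma and its orbits *)

Section orbits.
Context (R : realType).
Local Notation tau := (@tau R).
Implicit Types (p q r : 'rV[R]_4).

(** A general element of Gamma: [k] counts the passages through the suspension, [l] the turns of the
    circle, and (u, v) is a lattice translation. Scaling x by e^(k tau) while lowering s by k tau
    preserves e^(2s) dx^2, and similarly for y. *)
Definition deck (k l : int) (u v : R) p : 'rV[R]_4 :=
  vec4 (p 0 cx * expR (k%:~R * tau) + u) (p 0 cy * expR (- (k%:~R * tau)) + v)
       (p 0 cs - k%:~R * tau) (p 0 ct + l%:~R * (pi *+ 2)).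

Definition orb p q := exists k l u v, lat u v /\ q = deck k l u v p.

Lemma deckK k l u v p :
  deck (- k) (- l) (- (u * expR (- (k%:~R * tau)))) (- (v * expR (k%:~R * tau)))
    (deck k l u v p) = p.
Proof.
have e1 : expR (k%:~R * tau) * expR (- (k%:~R * tau)) = 1.
  by rewrite -expRD subrr expR0.
apply: vec4P; rewrite !vec4E !intrN !mulNr ?opprK ?addrK ?subrK//.
  by rewrite mulrDl -mulrA e1 mulr1 addrK.
by rewrite mulrDl -mulrA [X in _ * X]mulrC e1 mulr1 addrK.
Qed.

Lemma orb_refl p : orb p p.
Proof.
exists 0, 0, 0, 0; split; first exact: lat0.
by apply: vec4P; rewrite !vec4E ?mulr0z !mul0r ?oppr0 ?expR0 ?mulr1 !addr0.
Qed.

Lemma orb_deck k l u v p : lat u v -> orb p (deck k l u v p).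
Proof. by move=> uv; exists k, l, u, v. Qed.

Lemma orb_sym p q : orb p q -> orb q p.
Proof.
move=> [k [l [u [v [uv ->]]]]]; exists (- k), (- l),
  (- (u * expR (- (k%:~R * tau)))), (- (v * expR (k%:~R * tau))).
split; last by rewrite deckK.
apply: latN; rewrite ![_ * expR _]mulrC.
by have := lat_expR (- k) uv; rewrite intrN mulNr opprK.
Qed.

Lemma orb_trans p q r : orb p q -> orb q r -> orb p r.
Proof.
move=> [k [l [u [v [uv ->]]]]] [k' [l' [u' [v' [uv' ->]]]]].
exists (k + k'), (l + l'), (expR (k'%:~R * tau) * u + u'),
  (expR (- (k'%:~R * tau)) * v + v'); split.
  by apply: latD => //; exact: lat_expR.
by apply: vec4P; rewrite !vec4E ?intrD ?mulrDl ?opprD ?expRD; ring.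
Qed.

Lemma intr_small (n : int) (a e : R) : 0 < e -> e <= a ->
  `|n%:~R * a| < e -> n = 0.
Proof.
move=> e0 ea; apply: contraPeq => n0; apply/negP; rewrite -leNgt normrM.
rewrite [`|a|]gtr0_norm ?(lt_le_trans e0)//.
rewrite (le_trans ea)// ler_peMl//; first by rewrite (le_trans (ltW e0)).
by rewrite -intr_norm ler1z -gtz0_ge1 normr_gt0.
Qed.

Lemma two_le_pi2 : 2 <= pi *+ 2 :> R.
Proof. by have := @pi_ge2 R; lra. Qed.

(** The sum of the two conjugates is 2a and their difference is 2b sqrt 3. *)
Lemma lat_small u v : @lat R u v -> `|u| < 1 / 2 -> `|v| < 1 / 2 ->
  u = 0 /\ v = 0.
Proof.
move=> [a [b [-> ->]]] hu hv; have /andP[w1 _] := sqrt3_bounds R.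
move: hu hv; rewrite !ltr_norml => /andP[u1 u2] /andP[v1 v2].
have -> : a = 0.
  by apply: (@intr_small a 1 1) => //; rewrite mulr1 ltr_norml; apply/andP; split; lra.
have -> : b = 0.
  apply: (@intr_small b (sqrt3 R) 1) => //; first by lra.
  by rewrite ltr_norml; apply/andP; split; lra.
by rewrite mulr0z; split; ring.
Qed.

(** The action is free with a uniform separation: the shift of s excludes k <> 0 because tau >= 1/2,
    that of t excludes l <> 0, and what remains is a short lattice vector. *)
Lemma orb_small p q : orb p q -> ball p (1 / 2) q -> p = q.
Proof.
move=> [k [l [u [v [uv ->]]]]] /ball4P; rewrite !vec4E.
have tau2 := tau_ge_half R; have pi2 := two_le_pi2.
move=> [hx hy hs ht].
have k0 : k = 0.
  apply: (@intr_small k tau (1/2)) => //.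
  by move: hs; rewrite opprD opprK addNKr.
have l0 : l = 0.
  apply: (@intr_small l (pi *+ 2) (1/2)) => //; first by lra.
  by move: ht; rewrite opprD addNKr normrN.
subst k l; move: hx hy.
rewrite mulr0z mul0r oppr0 expR0 !mulr1 !opprD !addNKr !normrN => hu hv.
have [-> ->] := lat_small uv hu hv.
by apply: vec4P; rewrite vec4E mulr0z mul0r ?oppr0 ?expR0 ?mulr1 addr0.
Qed.

Lemma closed_multiples (a z : R) : 0 < a ->
  (forall e, 0 < e -> exists k : int, `|z - k%:~R * a| < e) ->
  exists k : int, z = k%:~R * a.
Proof.
move=> a0 h; have [|k hk] := h (a / 2); first by rewrite divr_gt0.
exists k; apply/eqP; rewrite -subr_eq0 -normr_eq0 -[_ == 0]negbK.
apply/negP => zk0.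
(* If z is not the first multiple, an approximation closer than that multiple must use another one;
   yet two multiples within a/2 of z coincide. *)
have [|k' hk'] := h (Num.min (a / 2) `|z - k%:~R * a|).
  by rewrite lt_min divr_gt0//= lt0r zk0 normr_ge0.
move: hk'; rewrite lt_min => /andP[h1 h2].
suff kk : k' - k = 0.
  by move: h2; rewrite (_ : k' = k) ?ltxx//; apply/eqP; rewrite -subr_eq0 kk.
apply: (@intr_small _ a a) => //; rewrite intrB mulrBl.
move: hk h1; rewrite !ltr_norml => /andP[? ?] /andP[? ?]; apply/andP; split; lra.
Qed.

(** The orbit relation is closed, which makes the quotient Hausdorff. The s and t coordinates
    determine k and l by discreteness; the translation part is then a limit of lattice vectors, and
    the lattice is recovered from the closed groups 2Z and 2 sqrt 3 Z of sums and differences. *)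
Lemma orb_closed p q :
  (forall e, 0 < e -> exists p' q', [/\ ball p e p', ball q e q' & orb p' q']) ->
  orb p q.
Proof.
move=> h; have t0 := tau_gt0 R; have pi0 : 0 < pi *+ 2 :> R.
  by have := two_le_pi2; lra.
have [k hk] : exists k : int, p 0 cs - q 0 cs = k%:~R * tau.
  apply: closed_multiples => // e e0; have [|p' [q' []]] := h (e / 2).
    by rewrite divr_gt0.
  move=> /ball4P[_ _ hp _] /ball4P[_ _ hq _] [k [l [u [v [uv E]]]]].
  exists k; move: hp hq; rewrite E vec4E !ltr_norml => /andP[? ?] /andP[? ?].
  by apply/andP; split; lra.
have [l hl] : exists l : int, q 0 ct - p 0 ct = l%:~R * (pi *+ 2).
  apply: closed_multiples => // e e0; have [|p' [q' []]] := h (e / 2).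
    by rewrite divr_gt0.
  move=> /ball4P[_ _ _ hp] /ball4P[_ _ _ hq] [k' [l [u [v [uv E]]]]].
  exists l; move: hp hq; rewrite E vec4E !ltr_norml => /andP[? ?] /andP[? ?].
  by apply/andP; split; lra.
set E1 := expR (k%:~R * tau); set E2 := expR (- (k%:~R * tau)).
pose u := q 0 cx - p 0 cx * E1; pose v := q 0 cy - p 0 cy * E2.
have E1_gt0 : 0 < E1 := expR_gt0 _; have E2_gt0 : 0 < E2 := expR_gt0 _.
have huv e : 0 < e -> exists u' v',
    [/\ lat u' v', `|u - u'| < e & `|v - v'| < e].
  (* The bound tau / 2 forces the approximating pair to use the same k; the factor 1 + E1 + E2
     absorbs the scaling of the error on p by the deck transformation. *)
  move=> e0; pose d := Num.min (tau / 2) (e / (1 + E1 + E2)).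
  have d0 : 0 < d by rewrite lt_min divr_gt0//= divr_gt0//; lra.
  have dt : d <= tau / 2 by rewrite ge_min lexx.
  have de : d * (1 + E1 + E2) <= e.
    by rewrite -ler_pdivlMr ?ge_min ?lexx ?orbT//; lra.
  have [p' [q' []]] := h d d0.
  move=> /ball4P[px py ps _] /ball4P[qx qy qs _] [k' [l' [u' [v' [uv' E]]]]].
  have k'k : k' = k.
    apply/eqP; rewrite -subr_eq0; apply/eqP.
    apply: (@intr_small _ tau tau) => //; rewrite intrB mulrBl -hk.
    move: ps qs; rewrite E vec4E !ltr_norml => /andP[? ?] /andP[? ?].
    by apply/andP; split; lra.
  exists u', v'; split => //.
    move: px qx; rewrite E vec4E k'k -/E1 !ltr_norml => /andP[? ?] /andP[? ?].
    by rewrite /u; apply/andP; split; nra.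
  move: py qy; rewrite E vec4E k'k -/E2 !ltr_norml => /andP[? ?] /andP[? ?].
  by rewrite /v; apply/andP; split; nra.
have /andP[w1 _] := sqrt3_bounds R.
have [a ha] : exists a : int, u + v = a%:~R * 2.
  apply: closed_multiples => // e e0; have [|u' [v' []]] := huv (e / 2).
    by rewrite divr_gt0.
  move=> [a [b [-> ->]]]; rewrite !ltr_norml => /andP[? ?] /andP[? ?].
  by exists a; rewrite ltr_norml; apply/andP; split; lra.
have [b hb] : exists b : int, u - v = b%:~R * (2 * sqrt3 R).
  apply: closed_multiples => [|e e0]; first by lra.
  have [|u' [v' []]] := huv (e / 2); first by rewrite divr_gt0.
  move=> [a' [b [-> ->]]]; rewrite !ltr_norml => /andP[? ?] /andP[? ?].
  by exists b; rewrite ltr_norml; apply/andP; split; lra.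
exists k, l, u, v; split; first by exists a, b; split; lra.
by apply: vec4P; rewrite !vec4E /u /v -/E1 -/E2 -?hk -?hl; ring.
Qed.

(** It meets every orbit but is larger than a fundamental domain. Reducing x + y into [0, 2] and x -
    y into [0, 2 sqrt 3] puts x in [0, 1 + sqrt 3] and y in [- sqrt 3, 1], both inside [-3, 3]. *)
Definition fund_box : set 'rV[R]_4 := [set p |
  [/\ -3 <= p 0 cx <= 3, -3 <= p 0 cy <= 3, 0 <= p 0 cs <= tau
    & 0 <= p 0 ct <= pi *+ 2]].

Lemma orb_fund_box p : exists2 q, fund_box q & orb p q.
Proof.
have t0 := tau_gt0 R; have pi0 : 0 < pi *+ 2 :> R by have := two_le_pi2; lra.
have fl (z a : R) : 0 < a -> exists k : int, 0 <= z - k%:~R * a <= a.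
  move=> a0; exists (Num.floor (z / a)).
  have /andP[h1 h2] := floor_itv (z / a).
  move: h1 h2; rewrite ler_pdivlMr// ltr_pdivrMr// intrD mulrDl mul1r => h1 h2.
  by apply/andP; split; lra.
have [k hk] := fl (p 0 cs) tau t0.
have [l hl] := fl (p 0 ct) (pi *+ 2) pi0.
pose x := p 0 cx * expR (k%:~R * tau); pose y := p 0 cy * expR (- (k%:~R * tau)).
have /andP[w1 w2] := sqrt3_bounds R.
have [a ha] := fl (x + y) 2 ltac:(lra).
have [b hb] := fl (x - y) (2 * sqrt3 R) ltac:(lra).
exists (deck k (- l) (- (a%:~R + b%:~R * sqrt3 R)) (- (a%:~R - b%:~R * sqrt3 R)) p).
  move: ha hb hk hl => /andP[? ?] /andP[? ?] ? ?.
  split; rewrite vec4E -/x -/y ?intrN ?mulNr//; apply/andP; split; lra.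
by apply: orb_deck; apply: latN; exists a, b.
Qed.

Lemma is_diff_deck k l u v p :
  is_diff p (deck k l u v) (fun h => h *m jac (k%:~R * tau) 0).
Proof.
rewrite /deck.
rewrite (_ : (fun h => h *m _) = fun h : 'rV[R]_4 =>
  vec4 (expR (k%:~R * tau) * h 0 cx) (expR (- (k%:~R * tau)) * h 0 cy)
       (1 * h 0 cs) (1 * h 0 ct)); last first.
  apply/funext => h; rewrite mul_jac mul0r addr0 !mul1r.
  by rewrite ![expR _ * _]mulrC.
apply: is_diff_vec4.
- apply: (is_diff_coord_real (G := fun z => z * expR (k%:~R * tau) + u)).
  by apply: is_derive_eq; rewrite /GRing.scale/= ?mulr0 ?add0r ?addr0 mulr1.
- apply: (is_diff_coord_real (G := fun z => z * expR (- (k%:~R * tau)) + v)).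
  by apply: is_derive_eq; rewrite /GRing.scale/= ?mulr0 ?add0r ?addr0 mulr1.
- apply: (is_diff_coord_real (G := fun z => z - k%:~R * tau)).
  by apply: is_derive_eq; rewrite subr0.
- apply: (is_diff_coord_real (G := fun z => z + l%:~R * (pi *+ 2))).
  by apply: is_derive_eq; rewrite addr0.
Qed.

Lemma deck_continuous k l u v : continuous (deck k l u v).
Proof.
by move=> p; have [/differentiable_continuous] := is_diff_deck k l u v p.
Qed.

End orbits.

Local Open Scope quotient_scope.

Section quotient_manifold.
Context (R : realType).
Implicit Types (p q : 'rV[R]_4).

Definition orbb p q : bool := `[< orb p q >].

Lemma orbb_refl : reflexive orbb.
Proof. by move=> p; apply/asboolP; exact: orb_refl. Qed.

Lemma orbb_sym : symmetric orbb.
Proof.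
by move=> p q; apply/idP/idP => /asboolP h; apply/asboolP; exact: orb_sym.
Qed.

Lemma orbb_trans : transitive orbb.
Proof.
by move=> q p r /asboolP pq /asboolP qr; apply/asboolP; exact: orb_trans qr.
Qed.

Canonical orb_equiv := EquivRel orbb orbb_refl orbb_sym orbb_trans.

Definition orbspace : topologicalType := quotient_topology {eq_quot orb_equiv}.

Definition proj p : orbspace := \pi_({eq_quot orb_equiv}) p.

Definition repr_pt (x : orbspace) : 'rV[R]_4 := repr (x : {eq_quot orb_equiv}).

Lemma repr_ptK x : proj (repr_pt x) = x.
Proof. exact: reprK. Qed.

Lemma projP p q : proj p = proj q <-> orb p q.
Proof.
by split=> [/(@eqmodP _ orb_equiv)/asboolP//|h]; exact/(@eqmodP _ orb_equiv)/asboolP.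
Qed.

Lemma orb_repr_pt p : orb p (repr_pt (proj p)).
Proof. by apply/projP; rewrite repr_ptK. Qed.

Lemma proj_deck k l u v p : @lat R u v -> proj (deck k l u v p) = proj p.
Proof. by move=> uv; apply/esym/projP; exact: orb_deck. Qed.

Lemma proj_continuous : continuous proj.
Proof. exact: pi_continuous. Qed.

(** The preimage of the image of V is the union of the translates of V. *)
Lemma proj_open (V : set 'rV[R]_4) : open V -> open (proj @` V).
Proof.
move=> oV; rewrite /open/= /quotient_open.
rewrite openE => q [p Vp /projP/orb_sym[k [l [u [v [uv E]]]]]].
have nV : \forall q' \near q, V (deck k l u v q').
  by apply: (@deck_continuous R k l u v q V); rewrite -E; exact: open_nbhs_nbhs.
rewrite /interior; apply: filterS nV => q' Vq'; exists (deck k l u v q') => //.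
by rewrite proj_deck.
Qed.

Lemma orbspace_hausdorff : hausdorff_space orbspace.
Proof.
move=> x y xy; rewrite -(repr_ptK x) -(repr_ptK y); apply/projP.
apply: orb_closed => e e0.
have [||z [[p' pp' E1] [q' qq' E2]]] := xy (proj @` ball (repr_pt x) e)
    (proj @` ball (repr_pt y) e).
- apply: open_nbhs_nbhs; split; first by apply: proj_open; exact: ball_open.
  by exists (repr_pt x); [exact: ballxx|exact: repr_ptK].
- apply: open_nbhs_nbhs; split; first by apply: proj_open; exact: ball_open.
  by exists (repr_pt y); [exact: ballxx|exact: repr_ptK].
by exists p', q'; split => //; apply/projP; rewrite E1.
Qed.

Lemma fund_box_compact : compact (@fund_box R).
Proof.
pose A (i : 'I_4) : set R :=
  [set` nth `[0, 0] [:: `[-3, 3]; `[-3, 3]; `[0, tau R]; `[0, pi *+ 2]] i].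
rewrite (_ : @fund_box R = [set v : 'rV[R]_4 | forall i, A i (v 0 i)]).
  by apply: rV_compact; apply: forall_ord4; exact: segment_compact.
apply/seteqP; split=> p.
  move=> [h1 h2 h3 h4]; apply: forall_ord4; by rewrite /A/= in_itv.
move=> /= h; split.
- by have := h cx; rewrite /A/= in_itv.
- by have := h cy; rewrite /A/= in_itv.
- by have := h cs; rewrite /A/= in_itv.
- by have := h ct; rewrite /A/= in_itv.
Qed.

Lemma orbspace_compact : compact [set: orbspace].
Proof.
have -> : [set: orbspace] = proj @` @fund_box R.
  apply/seteqP; split => // x _.
  have [q Kq xq] := orb_fund_box (repr_pt x).
  by exists q => //; rewrite -(repr_ptK x); apply/esym/projP.
apply: continuous_compact; last exact: fund_box_compact.
by apply: continuous_subspaceT; exact: proj_continuous.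
Qed.

Lemma orbspace_second_countable : @second_countable orbspace.
Proof.
pose B (c : 'rV[rat]_4 * nat) :=
  proj @` ball (map_mx ratr c.1 : 'rV[R]_4) (c.2.+1%:R^-1 : R).
exists (range B); first exact: card_le_trans (card_image_le B _) (countableP _).
split=> [_ [c _ <-]|x W].
  by apply: proj_open; exact: ball_open.
rewrite -{1}(repr_ptK x) => /proj_continuous/nbhs_ballP[e /= e0 He].
pose N := Num.truncn (2 / e); have Ne : 2 / e < N.+1%:R.
  by rewrite truncnS_gt.
have Ne' : N.+1%:R^-1 < e / 2.
  by rewrite -[e / 2]invrK ltf_pV2 ?posrE ?invr_gt0 ?divr_gt0// invf_div.
have N0 : 0 < N.+1%:R^-1 :> R by rewrite invr_gt0.
have [c hc] : exists c : 'rV[rat]_4,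
    ball (map_mx ratr c : 'rV[R]_4) N.+1%:R^-1 (repr_pt x).
  have ex (z : R) : exists r : rat, `|ratr r - z| < N.+1%:R^-1.
    have [|r] := @rat_in_itvoo R (z - N.+1%:R^-1) (z + N.+1%:R^-1).
      by rewrite ltrD2l gtrN.
    by rewrite in_itv/= => hr; exists r; rewrite ltr_distl.
  have [f hf] := choice ex.
  exists (\row_i f (repr_pt x 0 i)); split => // i j.
  by rewrite ord1 !mxE; exact: hf.
exists (B (c, N)).
  by split; [exists (c, N)|exists (repr_pt x) => //; exact: repr_ptK].
move=> _ [q hq <-]; apply: He.
rewrite (splitr e); apply: (@ball_triangle _ _ (map_mx ratr c : 'rV[R]_4)).
  by apply: ball_sym; exact: le_ball (ltW Ne') _ hc.
exact: le_ball (ltW Ne') _ hq.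
Qed.

(* The charts are the local sections of [proj] over balls of radius 1/4, on which
   [proj] is injective by [orb_small]. *)
Definition cbox p : set 'rV[R]_4 := ball p (1 / 4 : R).

Lemma cbox_center p : cbox p p.
Proof. by apply: ballxx; rewrite divr_gt0. Qed.

Lemma proj_inj_cbox p : {in cbox p &, injective proj}.
Proof.
move=> q q'; rewrite !inE => hq hq' /projP/orb_small; apply.
rewrite (_ : 1 / 2 = 1 / 4 + 1 / 4 :> R); last by lra.
by apply: ball_triangle hq'; exact: ball_sym.
Qed.

Definition sect p (x : orbspace) : 'rV[R]_4 :=
  xget p [set q | cbox p q /\ proj q = x].

Lemma sectP p q : cbox p q -> sect p (proj q) = q.
Proof.
move=> pq; rewrite /sect; case: xgetP => [q' _ [pq' E]|/(_ q)].
  by apply: (@proj_inj_cbox p); rewrite ?inE.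
by case.
Qed.

Lemma sectK p x : (proj @` cbox p) x -> proj (sect p x) = x.
Proof. by move=> [q pq <-]; rewrite sectP. Qed.

Lemma sect_img p : sect p @` (proj @` cbox p) = cbox p.
Proof.
apply/seteqP; split=> [_ [_ [q pq <-] <-]|q pq]; first by rewrite sectP.
by exists (proj q); [exists q|rewrite sectP].
Qed.

Lemma cbox_open p : open (cbox p).
Proof. exact: ball_open. Qed.

Lemma sect_continuous p : {within proj @` cbox p, continuous (sect p)}.
Proof.
rewrite continuous_open_subspace; last exact/proj_open/cbox_open.
move=> x; rewrite inE => -[q pq <-] W; rewrite sectP// => Wq.
rewrite nbhs_simpl/=.
have oWp : open (W° `&` cbox p) by apply: openI; [exact: open_interior|exact: cbox_open].
have : nbhs (proj q) (proj @` (W° `&` cbox p)).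
  apply: open_nbhs_nbhs; split; first exact: proj_open.
  by exists q => //; split => //; exact: nbhs_interior.
by apply: filterS => _ [q' [Wq' pq'] <-] /=; rewrite sectP//; exact: interior_subset.
Qed.

Definition qchart p : chart R 4 orbspace.
Proof.
refine (@Chart R 4 orbspace (proj @` cbox p) (sect p) proj _ _ _ _ _).
- exact/proj_open/cbox_open.
- by rewrite sect_img; exact: cbox_open.
- by move=> x /sectK.
- exact: sect_continuous.
- by apply: continuous_subspaceT; exact: proj_continuous.
Defined.

(** Near a point, a local section composed with [proj] is one fixed deck transformation. All
    computations in charts (transition maps, tangent maps, derivatives of the flow) rest on this. *)
Lemma sect_proj_deck p q : (proj @` cbox p) (proj q) ->
  exists k l u v, [/\ lat u v, cbox p (deck k l u v q)
    & \forall q' \near q, sect p (proj q') = deck k l u v q'].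
Proof.
move=> [q1 pq1 /esym/projP[k [l [u [v [uv E]]]]]].
exists k, l, u, v; split => //; first by rewrite -E.
have near_box : \forall q' \near q, cbox p (deck k l u v q').
  apply: (@deck_continuous R k l u v q (cbox p)); rewrite -E.
  by apply: open_nbhs_nbhs; split => //; exact: cbox_open.
by apply: filterS near_box => q' hq'; rewrite -(proj_deck k l q' uv) sectP.
Qed.

Lemma deck_smooth k l u v : smooth_on setT (@deck R k l u v).
Proof.
(* The successive derivatives of an affine function: z a + b, then a, then 0. *)
pose G (a b : R) (n : nat) (z : R) : R :=
  if n is m.+1 then (if m is 0 then a else 0) else z * a + b.
have hG a b n z : is_derive z (1 : R) (G a b n) (G a b n.+1 z).
  case: n => [|[|n]] /=; [|exact: is_derive_cst|exact: is_derive_cst].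
  by apply: is_derive_eq; rewrite /GRing.scale/= mulr0 add0r addr0 mulr1.
have S (i : 'I_4) (c d : R) (j : 'I_4) : smooth_on setT
    (fun p : 'rV[R]_4 => G c d 0%N (p 0 i) *: (delta_mx 0 j : 'rV[R]_4)).
  exact: (@smooth_on_coord_comp R 4 _ i (G c d) (delta_mx 0 j) (hG c d)).
rewrite (_ : deck k l u v =
  (fun p : 'rV[R]_4 => G (expR (k%:~R * tau R)) u 0%N (p 0 cx) *: delta_mx 0 cx) \+
  (fun p : 'rV[R]_4 => G (expR (- (k%:~R * tau R))) v 0%N (p 0 cy) *: delta_mx 0 cy) \+
  (fun p : 'rV[R]_4 => G 1 (- (k%:~R * tau R)) 0%N (p 0 cs) *: delta_mx 0 cs) \+
  (fun p : 'rV[R]_4 => G 1 (l%:~R * (pi *+ 2)) 0%N (p 0 ct) *: delta_mx 0 ct)).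
  by do 3 (apply: smooth_onD; last exact: S); exact: S.
by apply/funext => p; rewrite /deck vec4_sum /= !mulr1.
Qed.

Lemma qchart_compatible p p' :
  smooth_on (chart_map (qchart p) @` (chart_dom (qchart p) `&` chart_dom (qchart p')))
            (chart_map (qchart p') \o chart_inv (qchart p)).
Proof.
apply: smooth_on_near => _ [_ [[q pq <-] qp'] <-] /=; rewrite sectP//.
have [k [l [u [v [_ _ near_deck]]]]] := sect_proj_deck qp'.
by exists (deck k l u v) => //; exact: deck_smooth.
Qed.

Definition qmanifold : manifold R 4.
Proof.
refine (@Manifold R 4 orbspace (range qchart) (fun x => qchart (repr_pt x))
  orbspace_hausdorff orbspace_second_countable _ _ _).
- by move=> x; exists (repr_pt x).
- by move=> x; exists (repr_pt x); [exact: cbox_center|exact: repr_ptK].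
- by move=> _ _ [p _ <-] [p' _ <-]; exact: qchart_compatible.
Defined.

End quotient_manifold.

(** * The invariant metric and the fields X_eta *)

Section metric_and_fields.
Context (R : realType).
Local Notation tau := (@tau R).
Local Notation M := (qmanifold R).
Implicit Types (p q : 'rV[R]_4).

Lemma is_diff_sect p q : (@proj R @` cbox p) (proj q) ->
  exists k l u v, [/\ lat u v, sect p (proj q) = deck k l u v q &
    is_diff q (sect p \o @proj R) (fun h => h *m jac (k%:~R * tau) 0)].
Proof.
move=> /sect_proj_deck[k [l [u [v [uv pq near_deck]]]]]; exists k, l, u, v; split => //.
  exact: (nbhs_singleton near_deck).
exact: near_eq_is_diff near_deck (is_diff_deck k l u v q).
Qed.

Lemma sect_repr_pt (x : M) : sect (repr_pt x) x = repr_pt x.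
Proof. by rewrite -{2}(repr_ptK x) sectP//; exact: cbox_center. Qed.

Lemma dom_chart_at (x : M) : (@proj R @` cbox (repr_pt x)) x.
Proof. by exists (repr_pt x); [exact: cbox_center|exact: repr_ptK]. Qed.

Lemma tangent_to_qchart p (x : M) : (@proj R @` cbox p) x ->
  exists k l u v, [/\ lat u v, sect p x = deck k l u v (repr_pt x) &
    tangent_to_chart (M := M) (qchart p) x = jac (k%:~R * tau) 0].
Proof.
rewrite -{1}(repr_ptK x) => /is_diff_sect[k [l [u [v [uv E d]]]]].
exists k, l, u, v; split => //; first by rewrite -E repr_ptK.
by rewrite /tangent_to_chart /= sect_repr_pt; exact: jacobianE.
Qed.

Lemma tangent_of_qchart p q : cbox p q ->
  exists k l u v, [/\ lat u v, repr_pt (proj q) = deck k l u v q &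
    tangent_of_chart (M := M) (qchart p) (proj q) = jac (k%:~R * tau) 0].
Proof.
move=> pq; have [k [l [u [v [uv E d]]]]] := is_diff_sect (dom_chart_at (proj q)).
exists k, l, u, v; split => //; first by rewrite -E sect_repr_pt.
by rewrite /tangent_of_chart /= sectP//; exact: jacobianE.
Qed.

Definition speed (t : R) : R := tau * (2 + cos t).

Definition coord_field (eta : R) p : 'rV[R]_4 := vec4 0 0 (speed (p 0 ct)) eta.

Lemma periodic_int (f : R -> R) (a : R) (n : int) (t : R) :
  periodic f a -> f (t + n%:~R * a) = f t.
Proof.
move=> fa; have fN m s : f (s + m%:R * a) = f s.
  elim: m s => [|m ih] s; first by rewrite mul0r addr0.
  by rewrite -addn1 natrD mulrDl mul1r addrA fa ih.
case: n => m; first exact: fN.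
by rewrite NegzE intrN mulNr -[LHS](fN m.+1) subrK.
Qed.

Lemma speed_periodic (n : int) t : speed (t + n%:~R * (pi *+ 2)) = speed t.
Proof. by rewrite /speed (periodic_int _ _ (@cosD2pi R)). Qed.

(** Together with [coord_field_jac] this is the Gamma-invariance of the field, which therefore
    descends to the quotient. *)
Lemma coord_field_deck eta k l u v p :
  coord_field eta (deck k l u v p) = coord_field eta p.
Proof. by rewrite /coord_field vec4E speed_periodic. Qed.

Lemma coord_field_jac eta p k : coord_field eta p *m jac k 0 = coord_field eta p.
Proof. by rewrite mul_jac !vec4E !mul0r addr0. Qed.

Definition qfield_fun (eta : R) (x : M) : 'rV[R]_4 := coord_field eta (repr_pt x).

Lemma field_in_qchart eta p q : cbox p q ->
  field_in_chart (qfield_fun eta) (qchart p) q = coord_field eta q.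
Proof.
move=> pq; rewrite /field_in_chart /=.
have /tangent_to_qchart[k [l [u [v [uv]]]]] : (@proj R @` cbox p) (proj q) by exists q.
rewrite sectP// => E ->.
by rewrite /qfield_fun coord_field_jac [in RHS]E coord_field_deck.
Qed.

Lemma coord_field_smooth eta : smooth_on setT (coord_field eta).
Proof.
have [h cosDh] : exists h : R, forall a, cos (a + h) = - sin a.
  by exists (pi / 2) => a; exact: cosDpihalf.
(* Differentiating the cosine shifts its argument by a quarter period, which gives all its
   derivatives in one formula. *)
pose G n (z : R) : R := cos (z + n%:R * h).
have hG n z : is_derive z (1 : R) (G n) (G n.+1 z).
  apply: is_derive_eq; rewrite /G -natr1 mulrDl mul1r addrA cosDh.
  by rewrite /GRing.scale/= addr0 mulr1.
rewrite (_ : coord_field eta =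
  (fun p : 'rV[R]_4 => G 0%N (p 0 ct) *: (tau *: (delta_mx 0 cs : 'rV[R]_4))) \+
  (fun p : 'rV[R]_4 => (2 * tau) *: (delta_mx 0 cs : 'rV[R]_4) + eta *: delta_mx 0 ct)).
  apply: smooth_onD; last exact: smooth_on_cst.
  exact: (@smooth_on_coord_comp R 4 _ ct G _ hG).
apply/funext => p; rewrite /coord_field vec4_sum /= /G mul0r addr0 !scale0r !add0r.
by rewrite scalerA addrA -scalerDl; congr (_ *: _ + _); rewrite /speed; ring.
Qed.

Lemma qfield_smooth eta (c : chart R 4 M) : atlas c ->
  smooth_on (chart_img c) (field_in_chart (qfield_fun eta) c).
Proof.
move=> [p _ <-]; rewrite /chart_img /= sect_img; apply: smooth_on_near => q pq.
exists (coord_field eta); first exact: coord_field_smooth.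
have : nbhs q (cbox p) by apply: open_nbhs_nbhs; split => //; exact: cbox_open.
by apply: filterS => q' pq'; rewrite field_in_qchart.
Qed.

Definition qfield (eta : R) : vfield M := VField (@qfield_smooth eta).

Definition coord_gram p : 'M[R]_4 :=
  diag_mx (vec4 (expR (2 * p 0 cs)) (expR (-2 * p 0 cs)) 1 1).

Definition qgram_fun (x : M) : 'M[R]_4 := coord_gram (repr_pt x).

Lemma coord_gramE p (v : 'rV[R]_4) : (v *m coord_gram p *m v^T) 0 0 =
  v 0 cx ^+ 2 * expR (2 * p 0 cs) + v 0 cy ^+ 2 * expR (-2 * p 0 cs)
  + v 0 cs ^+ 2 + v 0 ct ^+ 2.
Proof. by rewrite mul_mx_diag !mxE sum_ord4 !mxE/=; ring. Qed.

Lemma qgram_sym x : (qgram_fun x)^T = qgram_fun x.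
Proof. by rewrite /qgram_fun /coord_gram tr_diag_mx. Qed.

Lemma qgram_posdef x (v : 'rV[R]_4) : v != 0 -> 0 < (v *m qgram_fun x *m v^T) 0 0.
Proof.
rewrite /qgram_fun coord_gramE => v0.
have e1 : 0 < expR (2 * repr_pt x 0 cs) := expR_gt0 _.
have e2 : 0 < expR (-2 * repr_pt x 0 cs) := expR_gt0 _.
have h0 := mulr_ge0 (sqr_ge0 (v 0 cx)) (ltW e1).
have h1 := mulr_ge0 (sqr_ge0 (v 0 cy)) (ltW e2).
have h2 := sqr_ge0 (v 0 cs); have h3 := sqr_ge0 (v 0 ct).
rewrite lt_neqAle; apply/andP; split; last by rewrite !addr_ge0.
apply: contra v0 => /eqP /esym E; apply/eqP.
have sq (a b : R) : 0 < b -> a ^+ 2 * b = 0 -> a = 0.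
  by move=> b0 /eqP; rewrite mulf_eq0 sqrf_eq0 (gt_eqF b0) orbF => /eqP.
apply: vec4P; rewrite mxE; apply: sq; [exact: e1|lra|exact: e2|lra|
  exact: ltr01|rewrite mulr1; lra|exact: ltr01|rewrite mulr1; lra].
Qed.

Lemma jac_diag (k : R) : jac k 0 = diag_mx (vec4 (expR k) (expR (- k)) 1 1).
Proof.
apply/row_matrixP => i; rewrite !rowE mul_jac mul_mx_diag.
by apply: vec4P; rewrite !mxE/= ?mul0r ?addr0 ?mulr1.
Qed.

Lemma form_in_qchart p q : cbox p q ->
  form_in_chart (M := M) qgram_fun (qchart p) q = coord_gram q.
Proof.
move=> pq; rewrite /form_in_chart /=.
have [k [l [u [v [uv E ->]]]]] := tangent_of_qchart pq.
rewrite /qgram_fun E /coord_gram vec4E jac_diag tr_diag_mx !mulmx_diag.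
congr diag_mx; apply: vec4P; rewrite !mxE/= ?mulr1// -!expRD; congr expR; ring.
Qed.

Lemma coord_gram_smooth : smooth_on setT coord_gram.
Proof.
pose G (c : R) n (z : R) : R := c ^+ n * expR (c * z).
have hG c n z : is_derive z (1 : R) (G c n) (G c n.+1 z).
  apply: is_derive_eq; rewrite /G /GRing.scale/= exprSr; ring.
rewrite (_ : coord_gram =
  (fun p : 'rV[R]_4 => G 2 0%N (p 0 cs) *: (delta_mx cx cx : 'M[R]_4)) \+
  (fun p : 'rV[R]_4 => G (-2) 0%N (p 0 cs) *: (delta_mx cy cy : 'M[R]_4)) \+
  (fun p : 'rV[R]_4 => delta_mx cs cs + delta_mx ct ct)).
  apply: smooth_onD; last exact: smooth_on_cst.
  apply: smooth_onD; first exact: (@smooth_on_coord_comp R 4 _ cs (G 2) _ (hG 2)).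
  exact: (@smooth_on_coord_comp R 4 _ cs (G (-2)) _ (hG (-2))).
apply/funext => p; apply/matrixP; rewrite /coord_gram /= /G !expr0 !mul1r.
apply: forall_ord4; apply: forall_ord4;
  by rewrite !mxE/= ?mulr1n ?mulr0n ?mulr1 ?mulr0 ?addr0 ?add0r.
Qed.

Lemma qgram_smooth (c : chart R 4 M) : atlas c ->
  smooth_on (chart_img c) (form_in_chart qgram_fun c).
Proof.
move=> [p _ <-]; rewrite /chart_img /= sect_img; apply: smooth_on_near => q pq.
exists coord_gram; first exact: coord_gram_smooth.
have : nbhs q (cbox p) by apply: open_nbhs_nbhs; split => //; exact: cbox_open.
by apply: filterS => q' pq'; rewrite form_in_qchart.
Qed.

Definition qmetric : riemannian_metric M :=
  RiemannianMetric qgram_sym qgram_posdef qgram_smooth.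

End metric_and_fields.

(** * The flow *)

Section drift.
Context (R : realType).
Local Notation tau := (@tau R).

(* The displacement of the s coordinate in time t, starting from theta; it is
   the integral of [speed (theta + eta * r)] for [r] from 0 to [t]. *)
Definition drift (eta t theta : R) : R :=
  if eta == 0 then t * speed theta
  else 2 * tau * t + tau * (sin (theta + eta * t) - sin theta) / eta.

Definition shear (eta t theta : R) : R :=
  if eta == 0 then - (tau * t * sin theta)
  else tau * (cos (theta + eta * t) - cos theta) / eta.

(** The cocycle identity over the rotation of the angle; it gives the group law of the flow. *)
Lemma driftD eta t t' theta :
  drift eta (t + t') theta = drift eta t' theta + drift eta t (theta + eta * t').
Proof.
rewrite /drift; case: eqVneq => [->|e0]; first by rewrite mul0r addr0; ring.
have -> : theta + eta * (t + t') = theta + eta * t' + eta * t by ring.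
by field.
Qed.

Lemma drift0 eta theta : drift eta 0 theta = 0.
Proof.
rewrite /drift; case: eqVneq => [_|_]; rewrite ?mul0r//.
by rewrite !mulr0 addr0 subrr mulr0 mul0r addr0.
Qed.

Lemma is_derive_drift_time eta t theta :
  is_derive t (1 : R) (drift eta ^~ theta) (speed (theta + eta * t)).
Proof.
rewrite /drift; case: eqVneq => [->|e0]; apply: is_derive_eq;
  rewrite /GRing.scale/= ?mul0r ?addr0 ?mulr0 ?add0r ?mulr1//.
by rewrite /speed; field.
Qed.

Lemma is_derive_drift_angle eta t theta :
  is_derive theta (1 : R) (drift eta t) (shear eta t theta).
Proof.
rewrite /drift /shear /speed; case: eqVneq => [_|e0]; apply: is_derive_eq;
  rewrite /GRing.scale/= ?mul0r ?addr0 ?mulr0 ?add0r ?mulr1.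
  by ring.
by field.
Qed.

Lemma drift_periodic eta t (n : int) theta :
  drift eta t (theta + n%:~R * (pi *+ 2)) = drift eta t theta.
Proof.
rewrite /drift speed_periodic addrAC.
by rewrite !(periodic_int _ _ (@sinD2pi R)).
Qed.

Lemma is_derive_lipschitz (f df : R -> R) :
  (forall x, is_derive x (1 : R) f (df x)) -> (forall x, `|df x| <= 1) ->
  forall a b, `|f a - f b| <= `|a - b|.
Proof.
move=> hf hd; suff h a b : a < b -> `|f a - f b| <= `|a - b|.
  move=> a b; have [ab|ba|->] := ltgtP a b; [exact: h| |by rewrite !subrr !normr0].
  by rewrite distrC [leRHS]distrC; exact: h.
move=> ab; have [|c _ E] := @MVT R f df a b ab (fun x _ => hf x).
  apply: derivable_within_continuous => x _.
  by have [] := hf x.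
by rewrite distrC E normrM [leRHS]distrC ler_piMl.
Qed.

Lemma sin_lipschitz (a b : R) : `|sin a - sin b| <= `|a - b|.
Proof. by apply: (is_derive_lipschitz (df := cos)) => x; exact: cos_max. Qed.

Lemma cos_lipschitz (a b : R) : `|cos a - cos b| <= `|a - b|.
Proof.
apply: (is_derive_lipschitz (df := fun x => - sin x)) => x.
by rewrite normrN; exact: sin_max.
Qed.

(** The speed is at least tau. For eta <> 0 this is read off the closed form, since the sine is
    1-Lipschitz. The bound is the same for all eta and provides the hyperbolicity. *)
Lemma drift_ge eta t theta : 0 <= t -> tau * t <= drift eta t theta.
Proof.
move=> t0; have tau0 := tau_gt0 R; rewrite /drift; case: eqVneq => [_|e0].
  rewrite /speed mulrCA ler_wpM2l ?(ltW tau0)// ler_peMr//.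
  by have := cos_geN1 theta; lra.
have h : `|(sin (theta + eta * t) - sin theta) / eta| <= t.
  rewrite normrM normfV ler_pdivrMr ?normr_gt0//.
  rewrite (le_trans (sin_lipschitz _ _))// addrAC subrr add0r normrM mulrC.
  by rewrite (ger0_norm t0).
move: h; rewrite ler_norml -mulrA => /andP[h _].
by have := ler_wpM2l (ltW tau0) h; lra.
Qed.

Lemma shear_le eta t theta : `|shear eta t theta| <= tau * `|t|.
Proof.
have tau0 := tau_gt0 R; rewrite /shear; case: eqVneq => [_|e0].
  rewrite normrN !normrM (gtr0_norm tau0) ler_piMr ?sin_max//.
  by rewrite mulr_ge0// ltW.
rewrite -mulrA normrM (gtr0_norm tau0) ler_wpM2l ?(ltW tau0)//.
rewrite normrM normfV ler_pdivrMr ?normr_gt0//.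
by rewrite (le_trans (cos_lipschitz _ _))// addrAC subrr add0r normrM mulrC.
Qed.

(** The averaging estimate: the oscillating term stays bounded in t, so only the mean speed 2 tau
    remains to first order. *)
Lemma drift_le eta t theta : eta != 0 ->
  drift eta t theta <= 2 * tau * t + 2 * tau / `|eta|.
Proof.
move=> e0; rewrite /drift (negbTE e0) lerD2l.
apply: le_trans (ler_norm _) _; rewrite !normrM (gtr0_norm (tau_gt0 R)) normfV.
rewrite [2 * tau]mulrC -!mulrA ler_pM2l ?tau_gt0// ler_wpM2r ?invr_ge0//.
rewrite (le_trans (ler_normB _ _))//.
by have := sin_max (theta + eta * t); have := sin_max theta; lra.
Qed.

(** The constant does not depend on t: for eta <> 0 the center direction contributes no separation
    of orbits in the long run. *)
Lemma drift_lipschitz eta t theta theta' : eta != 0 ->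
  `|drift eta t theta - drift eta t theta'| <=
  2 * tau / `|eta| * `|theta - theta'|.
Proof.
move=> e0; rewrite /drift (negbTE e0).
set a := sin (_ + _); set b := sin _; set c := sin (_ + _); set d := sin _.
have -> : 2 * tau * t + tau * (a - b) / eta - (2 * tau * t + tau * (c - d) / eta)
   = tau / eta * ((a - c) - (b - d)) by field.
rewrite !normrM (gtr0_norm (tau_gt0 R)) normfV.
rewrite [2 * tau]mulrC -!mulrA ler_pM2l ?tau_gt0// [2 * _]mulrCA.
rewrite ler_wpM2l ?invr_ge0//.
rewrite (le_trans (ler_normB _ _))//.
have := sin_lipschitz (theta + eta * t) (theta' + eta * t).
have -> : theta + eta * t - (theta' + eta * t) = theta - theta' by ring.
have := sin_lipschitz theta theta'; rewrite -/a -/b -/c -/d; lra.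
Qed.

End drift.

Section explicit_flow.
Context (R : realType).
Local Notation tau := (@tau R).
Local Notation M := (qmanifold R).
Implicit Types (p q : 'rV[R]_4).

Definition coord_flow (eta t : R) p : 'rV[R]_4 :=
  vec4 (p 0 cx) (p 0 cy) (p 0 cs + drift eta t (p 0 ct)) (p 0 ct + eta * t).

Lemma coord_flow_deck eta t k l u v p :
  coord_flow eta t (deck k l u v p) = deck k l u v (coord_flow eta t p).
Proof.
by rewrite /coord_flow /deck !vec4E drift_periodic; congr vec4; ring.
Qed.

Lemma coord_flow0 eta p : coord_flow eta 0 p = p.
Proof. by rewrite /coord_flow drift0 mulr0 !addr0 -vec4_eta. Qed.

Lemma coord_flowD eta t t' p :
  coord_flow eta (t + t') p = coord_flow eta t (coord_flow eta t' p).
Proof. by rewrite /coord_flow !vec4E driftD; congr vec4; ring. Qed.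

Lemma is_diff_coord_flow eta t p :
  is_diff p (coord_flow eta t) (fun h => h *m jac 0 (shear eta t (p 0 ct))).
Proof.
have -> : (fun h => h *m jac 0 (shear eta t (p 0 ct))) = fun h : 'rV[R]_4 =>
    vec4 (h 0 cx) (h 0 cy) (h 0 cs + shear eta t (p 0 ct) * h 0 ct) (1 * h 0 ct).
  by apply/funext => h; rewrite mul_jac oppr0 expR0 !mulr1 mul1r.
apply: is_diff_vec4; [exact: is_diff_coord|exact: is_diff_coord| |].
  apply: is_diffD; first exact: is_diff_coord.
  exact: (is_diff_coord_real (is_derive_drift_angle eta t (p 0 ct))).
apply: (is_diff_coord_real (G := fun z => z + eta * t)).
by apply: is_derive_eq; rewrite addr0.
Qed.

Lemma is_derive_vec4 (a b c d : R -> R) (t a' b' c' d' : R) :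
  is_derive t (1 : R) a a' -> is_derive t (1 : R) b b' ->
  is_derive t (1 : R) c c' -> is_derive t (1 : R) d d' ->
  is_derive t (1 : R) (fun s => vec4 (a s) (b s) (c s) (d s)) (vec4 a' b' c' d').
Proof.
move=> [ha <-] [hb <-] [hc <-] [hd <-].
pose F s := vec4 (a s) (b s) (c s) (d s).
have ea : (fun s => F s 0 cx) = a by apply/funext => s; exact: vec4x.
have eb : (fun s => F s 0 cy) = b by apply/funext => s; exact: vec4y.
have ec : (fun s => F s 0 cs) = c by apply/funext => s; exact: vec4s.
have ed : (fun s => F s 0 ct) = d by apply/funext => s; exact: vec4t.
have hF : derivable F t 1.
  apply/derivable_mxP => i; rewrite ord1.
  apply: (forall_ord4 (P := fun i => derivable (fun s => F s 0 i) t 1)).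
  - by rewrite ea; exact: ha.
  - by rewrite eb; exact: hb.
  - by rewrite ec; exact: hc.
  - by rewrite ed; exact: hd.
split => //; rewrite derive_mx//.
by apply: vec4P; rewrite mxE vec4E; [rewrite ea|rewrite eb|rewrite ec|rewrite ed].
Qed.

Lemma is_derive_coord (c : R -> 'rV[R]_4) (t : R) (dc : 'rV[R]_4) (i : 'I_4) :
  is_derive t (1 : R) c dc -> is_derive t (1 : R) (fun s => c s 0 i) (dc 0 i).
Proof.
move=> [hc <-]; rewrite derive_mx// mxE.
by split => //; exact: (derivable_mxP _ _ _).1.
Qed.

Lemma is_derive_diff_comp (V W : normedModType R) (f df : V -> W) (g : R -> V)
    (t : R) (dg : V) :
  is_derive t (1 : R) g dg -> is_diff (g t) f df ->
  is_derive t (1 : R) (f \o g) (df dg).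
Proof.
move=> [/derivable1_diffP hg <-] [hf <-].
have hfg : differentiable (f \o g) t by exact: differentiable_comp.
split; first exact: diff_derivable.
by rewrite !deriveE// diff_comp.
Qed.

Lemma is_derive_coord_flow eta t p :
  is_derive t (1 : R) (fun s => coord_flow eta s p)
    (coord_field eta (coord_flow eta t p)).
Proof.
rewrite /coord_flow /coord_field vec4E; apply: is_derive_vec4.
- rewrite -[speed _]add0r; apply: is_deriveD.
  exact: (is_derive_drift_time eta t (p 0 ct)).
- by apply: is_derive_eq; rewrite /GRing.scale/=; ring.
Qed.

Definition qflow (eta t : R) (x : M) : M := proj (coord_flow eta t (repr_pt x)).

Lemma qflow_proj eta t p : qflow eta t (proj p) = proj (coord_flow eta t p).
Proof.
have [k [l [u [v [uv E]]]]] := orb_repr_pt p.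
by rewrite /qflow E coord_flow_deck proj_deck.
Qed.

Lemma coord_flow_continuous_time eta p : continuous (fun t => coord_flow eta t p).
Proof.
move=> t; have [d _] := is_derive_coord_flow eta t p.
exact/differentiable_continuous/derivable1_diffP.
Qed.

Lemma is_derive_deck (c : R -> 'rV[R]_4) (eta t : R) k l u v q :
  c t = q -> is_derive t (1 : R) c (coord_field eta q) ->
  is_derive t (1 : R) (deck k l u v \o c) (coord_field eta (deck k l u v q)).
Proof.
move=> <- hc; rewrite coord_field_deck -(coord_field_jac eta (c t) (k%:~R * tau)).
exact: (is_derive_diff_comp hc (is_diff_deck k l u v (c t))).
Qed.

Lemma qflow_is_flow eta : is_flow_of (qfield eta) (qflow eta).
Proof.
split.
- by move=> x; rewrite /qflow coord_flow0 repr_ptK.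
- by move=> s t x; rewrite /qflow -/(qflow eta s _) qflow_proj coord_flowD.
- move=> x t; apply: (@continuous_comp _ _ _ (fun t => coord_flow eta t (repr_pt x)) (@proj R)).
    exact: coord_flow_continuous_time.
  exact: proj_continuous.
- move=> x t; rewrite /= /qfield_fun.
  set p := repr_pt x; set y : M := qflow eta t x.
  have [k [l [u [v [uv _ near_deck]]]]] := sect_proj_deck (dom_chart_at y).
  have E : repr_pt y = deck k l u v (coord_flow eta t p).
    by rewrite -(nbhs_singleton near_deck) -[LHS]sect_repr_pt.
  rewrite [X in coord_field _ X]E.
  apply: (near_eq_is_derive (f := deck k l u v \o (coord_flow eta ^~ p))
    (g := fun s => sect (repr_pt y) (proj (coord_flow eta s p)))).
    have near_t : \forall s \near t, sect (repr_pt y) (proj (coord_flow eta s p)) =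
        deck k l u v (coord_flow eta s p).
      exact: (@coord_flow_continuous_time eta p t _ near_deck).
    by apply: filterS near_t => s ->.
  exact: is_derive_deck (is_derive_coord_flow eta t p).
Qed.

(** Read in a chart, the equations are triangular and can be integrated one after the other: x and y
    are constant, the angle is affine in time, and s is then the drift along the known angle. *)
Lemma flow_locally_qflow eta (psi : R -> M -> M) (x : M) (t0 : R) :
  is_flow_of (qfield eta) psi ->
  \forall t \near t0, psi t x = qflow eta (t - t0) (psi t0 x).
Proof.
move=> [_ _ psi_cont psi_der].
set y := psi t0 x; set q := repr_pt y; pose c t := sect q (psi t x).
have dom_near : \forall t \near t0, (@proj R @` cbox q) (psi t x).
  apply: (psi_cont x t0); apply: open_nbhs_nbhs; split; last exact: dom_chart_at.
  exact/proj_open/cbox_open.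
have [d /= d0 Hd] := (nbhs_ballP _ _).1 dom_near.
have {}Hd t : `|t - t0| < d -> (@proj R @` cbox q) (psi t x).
  by move=> td; apply: Hd; rewrite /ball/= distrC.
have c_der t : `|t - t0| < d -> is_derive t (1 : R) c (coord_field eta (c t)).
  (* The derivative is given in the preferred chart at [psi t x], which varies with t; a deck
     transformation carries it to the fixed chart at y. *)
  move=> td; set z := psi t x; set b := fun s => sect (repr_pt z) (psi s x).
  have domz := Hd t td; rewrite -/z -(repr_ptK z) in domz.
  have [k [l [u [v [uv _ near_deck]]]]] := sect_proj_deck domz.
  have b_der : is_derive t (1 : R) b (coord_field eta (repr_pt z)) by exact: psi_der.
  have bt : b t = repr_pt z by exact: sect_repr_pt.
  have b_cont : {for t, continuous b}.
    by apply: differentiable_continuous; apply/derivable1_diffP; case: b_der.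
  have domz_near : \forall s \near t, (@proj R @` cbox (repr_pt z)) (psi s x).
    apply: (psi_cont x t); apply: open_nbhs_nbhs; split; last exact: dom_chart_at.
    exact/proj_open/cbox_open.
  have deck_near : \forall s \near t, sect q (proj (b s)) = deck k l u v (b s).
    by rewrite -bt in near_deck; exact: (b_cont _ near_deck).
  have cE : \forall s \near t, deck k l u v (b s) = c s.
    by apply: filterS2 deck_near domz_near => s <- /sectK ->.
  rewrite -(nbhs_singleton cE) bt.
  apply: (near_eq_is_derive (f := deck k l u v \o b)); first exact: cE.
  exact: is_derive_deck.
have c0 : c t0 = q by exact: sect_repr_pt.
have cx_cst t : `|t - t0| < d -> c t 0 cx = q 0 cx.
  rewrite -c0; apply: (derivative0_locally_constant (f := fun s => c s 0 cx)).
  by move=> s /c_der/(is_derive_coord cx); rewrite /coord_field vec4E.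
have cy_cst t : `|t - t0| < d -> c t 0 cy = q 0 cy.
  rewrite -c0; apply: (derivative0_locally_constant (f := fun s => c s 0 cy)).
  by move=> s /c_der/(is_derive_coord cy); rewrite /coord_field vec4E.
have ct_aff t : `|t - t0| < d -> c t 0 ct = q 0 ct + eta * (t - t0).
  move=> td; apply/eqP; rewrite -subr_eq -c0; apply/eqP.
  rewrite (derivative0_locally_constant (f := fun s => c s 0 ct - eta * (s - t0)) _ td).
    by rewrite subrr mulr0 subr0.
  move=> s /c_der/(is_derive_coord ct); rewrite /coord_field vec4E => h.
  by apply: is_derive_eq; rewrite /GRing.scale/=; ring.
have cs_drift t : `|t - t0| < d -> c t 0 cs = q 0 cs + drift eta (t - t0) (q 0 ct).
  move=> td; apply/eqP; rewrite -subr_eq -{2}c0; apply/eqP.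
  rewrite (derivative0_locally_constant
    (f := fun s => c s 0 cs - drift eta (s - t0) (q 0 ct)) _ td).
    by rewrite subrr drift0 subr0.
  move=> s sd; have := is_derive_coord cs (c_der s sd); rewrite /coord_field vec4E.
  rewrite ct_aff// => h; rewrite -(subrr (speed (q 0 ct + eta * (s - t0)))).
  apply: is_deriveB.
  have := is_derive_drift_time eta (s - t0) (q 0 ct) => h2.
  rewrite -[speed _]mulr1.
  have hs : is_derive s (1 : R) (fun s => s - t0) 1.
    by apply: is_derive_eq; rewrite subr0.
  exact: (is_derive1_comp (f := drift eta ^~ (q 0 ct)) (g := fun s => s - t0)).
apply/nbhs_ballP; exists d => // t; rewrite /ball/= distrC => td.
rewrite -(sectK (Hd t td)) -/(c t) /qflow -/q; congr proj.
by apply: vec4P; rewrite vec4E ?cx_cst ?cy_cst ?cs_drift ?ct_aff.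
Qed.

Lemma qflow_unique eta (psi : R -> M -> M) :
  is_flow_of (qfield eta) psi -> psi = qflow eta.
Proof.
move=> hpsi; have [f0 fD _ _] := qflow_is_flow eta.
apply/funext => t; apply/funext => x.
pose w s := qflow eta (- s) (psi s x).
have w_cst s : w s = w 0.
  apply: contrapT => ws.
  (* Connectedness of the line: the indicator of where [w] leaves its initial value is locally
     constant, so its derivative vanishes and it is constant. *)
  pose chi r : R := if `[< w r = w 0 >] then 0 else 1.
  have : chi s = chi 0.
    apply: is_derive_0_is_cst => r.
    apply: (near_eq_is_derive (f := cst (chi r))).
    have := flow_locally_qflow x r hpsi; apply: filterS => r' E.
    have wr : w r' = w r by rewrite /w E -fD; congr qflow; ring.
    by rewrite /chi wr.
  by rewrite /chi asboolF// asboolT// => /eqP; rewrite oner_eq0.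
have [psi0 _ _ _] := hpsi.
have := w_cst t; rewrite /w oppr0 f0 psi0 => /(congr1 (qflow eta t)).
by rewrite -fD subrr f0.
Qed.

Lemma flow_qfield eta : flow (qfield eta) = qflow eta.
Proof.
rewrite /flow; case: xgetP => [psi _ /qflow_unique//|].
by move=> /(_ (qflow eta))[]; exact: qflow_is_flow.
Qed.

End explicit_flow.

(** * Partial hyperbolicity *)

Section partial_hyperbolicity_of_qflow.
Context (R : realType).
Local Notation tau := (@tau R).
Local Notation M := (qmanifold R).
Local Notation g := (qmetric R).
Implicit Types (x y : M) (v : 'rV[R]_4).

Definition quad (s : R) v : R :=
  v 0 cx ^+ 2 * expR (2 * s) + v 0 cy ^+ 2 * expR (-2 * s)
  + v 0 cs ^+ 2 + v 0 ct ^+ 2.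

Lemma quad_ge0 s v : 0 <= quad s v.
Proof.
have h i (r : R) : 0 <= v 0 i ^+ 2 * expR r by rewrite mulr_ge0 ?sqr_ge0 ?expR_ge0.
by do 3 (apply: addr_ge0; last exact: sqr_ge0 || exact: h); exact: h.
Qed.

Lemma tnormE x v : tnorm g x v = Num.sqrt (quad (repr_pt x 0 cs) v).
Proof. by rewrite /tnorm /= /qgram_fun coord_gramE. Qed.

Lemma tnorm1 x v : tnorm g x v = 1 -> quad (repr_pt x 0 cs) v = 1.
Proof. by rewrite tnormE => h; rewrite -(sqr_sqrtr (quad_ge0 _ v)) h expr1n. Qed.

Lemma tnorm_le x v (b : R) : 0 <= b -> quad (repr_pt x 0 cs) v <= b ^+ 2 ->
  tnorm g x v <= b.
Proof. by move=> b0 h; rewrite tnormE -(ger0_norm b0) -sqrtr_sqr ler_wsqrtr. Qed.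

(** The exponent s' + k - s is the displacement of s along the lifted orbit: [k] undoes the deck
    shift hidden in the representative of the image point. *)
Lemma quad_jac s s' k h v : quad s' (v *m jac k h) =
  v 0 cx ^+ 2 * expR (2 * s) * expR (s' + k - s) ^+ 2
  + v 0 cy ^+ 2 * expR (-2 * s) * expR (- (s' + k - s)) ^+ 2
  + (v 0 cs + h * v 0 ct) ^+ 2 + v 0 ct ^+ 2.
Proof.
have E1 : expR k ^+ 2 * expR (2 * s') = expR (2 * s) * expR (s' + k - s) ^+ 2.
  by rewrite !expr2 -!expRD; congr expR; ring.
have E2 : expR (- k) ^+ 2 * expR (-2 * s') =
    expR (-2 * s) * expR (- (s' + k - s)) ^+ 2.
  by rewrite !expr2 -!expRD; congr expR; ring.
rewrite /quad mul_jac !vec4E !exprMn -[_ * expR (2 * s')]mulrA E1.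
by rewrite -[_ * expR (-2 * s')]mulrA E2 !mulrA.
Qed.

Lemma opnorm_le x y (A E : 'M[R]_4) (b : R) : 0 <= b ->
  (forall v, (v <= E)%MS -> tnorm g x v = 1 -> tnorm g y (v *m A) <= b) ->
  opnorm g x y A E <= b.
Proof.
move=> b0 h; rewrite /opnorm; set S := [set _ | _ in _].
have [->|S0] := eqVneq S set0; first by rewrite sup0.
apply: sup_le_ub; first exact/set0P.
by move=> _ [v [vE v1] <-]; exact: h.
Qed.

Lemma opnorm_ge0 x y (A E : 'M[R]_4) : 0 <= opnorm g x y A E.
Proof.
rewrite /opnorm; set S := [set _ | _ in _].
have [hS|/sup_out ->//] := pselect (has_sup S).
have [[r Sr] _] := hS; apply: (@le_trans _ _ r); last exact: sup_upper_bound.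
by case: Sr => v _ <-; rewrite tnormE sqrtr_ge0.
Qed.

Definition Estable : 'M[R]_4 := diag_mx (vec4 0 1 0 0).
Definition Ecenter : 'M[R]_4 := diag_mx (vec4 0 0 1 1).
Definition Eunstable : 'M[R]_4 := diag_mx (vec4 1 0 0 0).

Lemma mul_diag4 v (a b c d : R) : v *m diag_mx (vec4 a b c d) =
  vec4 (v 0 cx * a) (v 0 cy * b) (v 0 cs * c) (v 0 ct * d).
Proof. by rewrite mul_mx_diag; apply: vec4P; rewrite !mxE. Qed.

Lemma sub_Estable v : (v <= Estable)%MS -> v = vec4 0 (v 0 cy) 0 0.
Proof. by move=> /submxP[w ->]; rewrite mul_diag4 !vec4E !mulr0 mulr1. Qed.

Lemma sub_Eunstable v : (v <= Eunstable)%MS -> v = vec4 (v 0 cx) 0 0 0.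
Proof. by move=> /submxP[w ->]; rewrite mul_diag4 !vec4E !mulr0 mulr1. Qed.

Lemma sub_Ecs v : (v <= Estable + Ecenter)%MS -> v 0 cx = 0.
Proof.
move=> /sub_addsmxP[[u1 u2] ->] /=.
by rewrite !mul_diag4 mxE !vec4E !mulr0 addr0.
Qed.

Lemma sub_Ecu v : (v <= Ecenter + Eunstable)%MS -> v 0 cy = 0.
Proof.
move=> /sub_addsmxP[[u1 u2] ->] /=.
by rewrite !mul_diag4 mxE !vec4E !mulr0 addr0.
Qed.

Lemma jac_commute k h :
  [/\ Estable *m jac k h = jac k h *m Estable,
      Ecenter *m jac k h = jac k h *m Ecenter &
      Eunstable *m jac k h = jac k h *m Eunstable].
Proof.
by split; apply/row_matrixP => i; rewrite !rowE !mulmxA ?(mul_diag4, mul_jac) ?vec4E;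
  congr vec4; ring.
Qed.

(** The derivative is the shear of the lifted flow followed by the deck transformation that reaches
    the chosen representative; [k] is the amount by which the latter lowers s. *)
Lemma mderiv_qflow eta t x : exists2 k : R,
  repr_pt (qflow eta t x) 0 cs = repr_pt x 0 cs + drift eta t (repr_pt x 0 ct) - k &
  mderiv (qflow eta t) x = jac k (shear eta t (repr_pt x 0 ct)).
Proof.
set p := repr_pt x; set y := qflow eta t x.
have [k [l [u [v [uv _ near_deck]]]]] := sect_proj_deck (dom_chart_at y).
have E : repr_pt y = deck k l u v (coord_flow eta t p).
  by rewrite -(nbhs_singleton near_deck) -[LHS]sect_repr_pt.
exists (k%:~R * tau); first by rewrite E !vec4E.
rewrite /mderiv /= sect_repr_pt; apply: jacobianE.
have [dF dFE] := is_diff_coord_flow eta t p.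
have near_p : \forall q \near p, sect (repr_pt y) (proj (coord_flow eta t q)) =
    deck k l u v (coord_flow eta t q).
  exact: (differentiable_continuous dF near_deck).
apply: (near_eq_is_diff (g := deck k l u v \o coord_flow eta t)).
  by apply: filterS near_p => q Eq; rewrite /= qflow_proj -/y Eq.
have E2 : (fun h : 'rV[R]_4 => h *m jac (k%:~R * tau) (shear eta t (p 0 ct))) =
    (fun h => h *m jac (k%:~R * tau) 0) \o (fun h => h *m jac 0 (shear eta t (p 0 ct))).
  by apply/funext => h; rewrite /= -mulmxA jacM add0r addr0.
rewrite E2.
exact: is_diff_comp (is_diff_coord_flow eta t p) (is_diff_deck k l u v _).
Qed.

Lemma driftN (eta t theta : R) : drift eta (- t) theta = - drift eta t (theta - eta * t).
Proof.
apply/eqP; rewrite -addr_eq0 addrC; apply/eqP.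
by rewrite -{2}(subrK (eta * t) theta) -driftD addNr drift0.
Qed.

Lemma drift_le_neg (eta t theta : R) : 0 <= t -> drift eta (- t) theta <= - (tau * t).
Proof. by move=> t0; rewrite driftN lerN2; exact: drift_ge. Qed.

Lemma mderiv_quad eta t x v : exists D h : R,
  [/\ quad (repr_pt (qflow eta t x) 0 cs) (v *m mderiv (qflow eta t) x) =
      v 0 cx ^+ 2 * expR (2 * repr_pt x 0 cs) * expR D ^+ 2
      + v 0 cy ^+ 2 * expR (-2 * repr_pt x 0 cs) * expR (- D) ^+ 2
      + (v 0 cs + h * v 0 ct) ^+ 2 + v 0 ct ^+ 2,
      `|h| <= tau * `|t|, 0 <= t -> tau * t <= D &
      t <= 0 -> D <= tau * t].
Proof.
have [k E1 E2] := mderiv_qflow eta t x.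
exists (drift eta t (repr_pt x 0 ct)), (shear eta t (repr_pt x 0 ct)); split.
- rewrite E2 (quad_jac (repr_pt x 0 cs)) E1.
  by rewrite (_ : _ + k - _ = drift eta t (repr_pt x 0 ct))//; ring.
- exact: shear_le.
- exact: drift_ge.
- move=> t0; have := @drift_le_neg eta (- t) (repr_pt x 0 ct).
  by rewrite opprK mulrN opprK; apply; rewrite oppr_ge0.
Qed.

Lemma expR_powR (a t : R) : expR a `^ t = expR (a * t).
Proof. by rewrite /powR gt_eqF ?expR_gt0// expRK mulrC. Qed.

Lemma opnorm_stable eta t x : 0 <= t ->
  opnorm g x (qflow eta t x) (mderiv (qflow eta t) x) Estable <= expR (- (tau * t)).
Proof.
move=> t0; apply: opnorm_le => [|v /sub_Estable vE /tnorm1 v1]; first exact: expR_ge0.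
apply: tnorm_le; first exact: expR_ge0.
have [D [h [-> _ /(_ t0) hD _]]] := mderiv_quad eta t x v.
move: v1; rewrite vE /quad !vec4E !(expr0n, mul0r, mulr0, addr0, add0r)/= => ->.
by rewrite mul1r ler_pXn2r ?nnegrE ?expR_ge0// ler_expR lerN2.
Qed.

Lemma opnorm_unstable eta t x : 0 <= t ->
  opnorm g x (qflow eta (- t) x) (mderiv (qflow eta (- t)) x) Eunstable
  <= expR (- (tau * t)).
Proof.
move=> t0; apply: opnorm_le => [|v /sub_Eunstable vE /tnorm1 v1]; first exact: expR_ge0.
apply: tnorm_le; first exact: expR_ge0.
have Nt : - t <= 0 by rewrite oppr_le0.
have [D [h [-> _ _ /(_ Nt) hD]]] := mderiv_quad eta (- t) x v.
move: v1; rewrite vE /quad !vec4E !(expr0n, mul0r, mulr0, addr0, add0r)/= => ->.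
by rewrite mul1r ler_pXn2r ?nnegrE ?expR_ge0// ler_expR -mulrN.
Qed.

Lemma opnorm_unstable_inv eta t x : 0 <= t ->
  opnorm g (qflow eta t x) x (invmx (mderiv (qflow eta t) x))
    (Eunstable *m mderiv (qflow eta t) x) <= expR (- (tau * t)).
Proof.
move=> t0; have [k E1 ->] := mderiv_qflow eta t x.
set h := shear _ _ _; have [_ _ ->] := jac_commute k h.
apply: opnorm_le => [|v /(submx_trans)/(_ (submxMl _ _))]; first exact: expR_ge0.
move=> /sub_Eunstable vE /tnorm1 v1.
apply: tnorm_le; first exact: expR_ge0.
rewrite invmx_jac (quad_jac (repr_pt (qflow eta t x) 0 cs)).
move: v1; rewrite vE /quad !vec4E !(expr0n, mul0r, mulr0, addr0, add0r)/= => ->.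
rewrite mul1r E1 ler_pXn2r ?nnegrE ?expR_ge0// ler_expR.
by have := drift_ge eta (repr_pt x 0 ct) t0; lra.
Qed.

(** From (c + h d)^2 + (c - h d)^2 = 2 c^2 + 2 h^2 d^2. *)
Lemma shear_bound (T h c d : R) : 0 <= T -> `|h| <= T ->
  c ^+ 2 + d ^+ 2 <= 1 ->
  (c + h * d) ^+ 2 + d ^+ 2 <= 3 + 2 * T ^+ 2.
Proof.
move=> T0 hT cd.
have h2 : h ^+ 2 <= T ^+ 2 by rewrite -real_normK ?num_real// ler_pXn2r ?nnegrE.
have c2 := sqr_ge0 c; have d2 := sqr_ge0 d; have q := sqr_ge0 (c - h * d).
have hd : h ^+ 2 * d ^+ 2 <= T ^+ 2 * 1.
  by apply: ler_pM => //; [exact: sqr_ge0|lra].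
have -> : (c + h * d) ^+ 2 = 2 * c ^+ 2 + 2 * (h ^+ 2 * d ^+ 2) - (c - h * d) ^+ 2.
  by ring.
lra.
Qed.

Lemma opnorm_center_stable eta t x : 0 <= t ->
  opnorm g x (qflow eta t x) (mderiv (qflow eta t) x) (Estable + Ecenter)%MS
  <= 2 * (1 + tau * t).
Proof.
move=> t0; have T0 : 0 <= tau * t by rewrite mulr_ge0// ltW// tau_gt0.
apply: opnorm_le => [|v /sub_Ecs v0 /tnorm1]; first by lra.
rewrite /quad v0 !(expr0n, mul0r, add0r)/= => v1.
apply: tnorm_le; first by lra.
have [D [h [-> hh /(_ t0) hD _]]] := mderiv_quad eta t x v.
rewrite (ger0_norm t0) in hh.
have e1 : expR (- D) ^+ 2 <= 1.
  by rewrite expr_le1 ?expR_ge0// expR_le1; lra.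
have B0 : 0 <= v 0 cy ^+ 2 * expR (-2 * repr_pt x 0 cs).
  by rewrite mulr_ge0 ?sqr_ge0 ?expR_ge0.
have BD := ler_wpM2l B0 e1.
rewrite v0 !(expr0n, mul0r, add0r)/=.
have h1 := sqr_ge0 (v 0 cs); have h2 := sqr_ge0 (v 0 ct).
have := shear_bound (c := v 0 cs) (d := v 0 ct) T0 hh ltac:(lra).
set T := tau * t in T0 *; have T2 := sqr_ge0 T.
(* The stable component contributes at most 1 and the sheared center at most 3 + 2 T^2, which this
   square dominates. *)
have -> : (2 * (1 + T)) ^+ 2 = 4 + 8 * T + 4 * T ^+ 2 by ring.
lra.
Qed.

Lemma opnorm_center_unstable eta t x : 0 <= t ->
  opnorm g x (qflow eta (- t) x) (mderiv (qflow eta (- t)) x)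
    (Ecenter + Eunstable)%MS <= 2 * (1 + tau * t).
Proof.
move=> t0; have T0 : 0 <= tau * t by rewrite mulr_ge0// ltW// tau_gt0.
apply: opnorm_le => [|v /sub_Ecu v0 /tnorm1]; first by lra.
rewrite /quad v0 !(expr0n, mul0r, add0r, addr0)/= => v1.
apply: tnorm_le; first by lra.
have Nt : - t <= 0 by rewrite oppr_le0.
have [D [h [-> hh _ /(_ Nt) hD]]] := mderiv_quad eta (- t) x v.
rewrite normrN (ger0_norm t0) in hh.
have e1 : expR D ^+ 2 <= 1.
  by rewrite expr_le1 ?expR_ge0// expR_le1; rewrite mulrN in hD; lra.
have B0 : 0 <= v 0 cx ^+ 2 * expR (2 * repr_pt x 0 cs).
  by rewrite mulr_ge0 ?sqr_ge0 ?expR_ge0.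
have BD := ler_wpM2l B0 e1.
rewrite v0 !(expr0n, mul0r, add0r, addr0)/=.
have h1 := sqr_ge0 (v 0 cs); have h2 := sqr_ge0 (v 0 ct).
have := shear_bound (c := v 0 cs) (d := v 0 ct) T0 hh ltac:(lra).
set T := tau * t in T0 *; have T2 := sqr_ge0 T.
have -> : (2 * (1 + T)) ^+ 2 = 4 + 8 * T + 4 * T ^+ 2 by ring.
lra.
Qed.

(* The linear growth of the shear is absorbed by half of the expansion rate. *)
Lemma linear_le_expR (T : R) : 0 <= T ->
  2 * (1 + T) * expR (- T) <= 4 * expR (- (T / 2)).
Proof.
move=> T0; have h := expR_ge1Dx (T / 2).
have -> : expR (- T) = expR (- (T / 2)) * expR (- (T / 2)).
  by rewrite -expRD; congr expR; field.
have e0 := expR_gt0 (- (T / 2)).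
have ee : expR (T / 2) * expR (- (T / 2)) = 1 by rewrite -expRD subrr expR0.
set e := expR (- (T / 2)) in e0 ee *.
have h1 : (1 + T) * e <= 2.
  have -> : 2 = 2 * expR (T / 2) * e by rewrite -mulrA ee mulr1.
  by rewrite ler_pM2r//; lra.
have -> : 2 * (1 + T) * (e * e) = 2 * e * ((1 + T) * e) by ring.
have -> : 4 * e = 2 * e * 2 by ring.
by rewrite ler_pM2l// mulr_gt0.
Qed.

Lemma qflow_orbit_inv eta t x : qflow eta (- t) (qflow eta t x) = x.
Proof.
by have [f0 fD _ _] := qflow_is_flow eta; rewrite -fD addNr f0.
Qed.

Lemma qfield_ph eta : ph_fields g 2 (qfield eta).
Proof.
rewrite /ph_fields /= flow_qfield.
have t0 := tau_gt0 R.
have lam (a : R) : 0 < a -> 0 < expR (- a) < 1.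
  by move=> a0; rewrite expR_gt0/= expR_lt1 oppr_lt0.
have full : (Estable + Ecenter + Eunstable :=: 1%:M)%MS.
  apply/eqmxP; rewrite submx1/=.
  rewrite (_ : 1%:M = (Estable + Ecenter + Eunstable)%R); last first.
    by apply/row_matrixP => i; rewrite !rowE mulmx1 !mulmxDr !mul_diag4;
      apply: vec4P; rewrite !mxE/= ?mulr0 ?mulr1 ?addr0 ?add0r.
  by rewrite !addmx_sub_adds.
have rs : \rank Estable = 1%N.
  rewrite (_ : Estable = delta_mx cy cy) ?mxrank_delta//.
  by apply/matrixP; apply: forall_ord4; apply: forall_ord4; rewrite !mxE.
have ru : \rank Eunstable = 1%N.
  rewrite (_ : Eunstable = delta_mx cx cx) ?mxrank_delta//.
  by apply/matrixP; apply: forall_ord4; apply: forall_ord4; rewrite !mxE.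
have rc : \rank Ecenter = 2%N.
  apply/eqP; rewrite eqn_leq; apply/andP; split.
    rewrite (_ : Ecenter = delta_mx cs cs + delta_mx ct ct).
      by rewrite (leq_trans (mxrank_add _ _))// !mxrank_delta.
    apply/matrixP; apply: forall_ord4; apply: forall_ord4;
      by rewrite !mxE/= ?addr0 ?add0r.
  (* The lower bound on the rank is 4 - 1 - 1, because the three bundles span. *)
  have : (4 <= \rank (Estable + Ecenter + Eunstable)%MS)%N by rewrite full mxrank1.
  move=> /leq_trans/(_ (mxrank_adds_leqif _ _)).
  rewrite ru addn1 ltnS => /leq_trans/(_ (mxrank_adds_leqif _ _)).
  by rewrite rs add1n ltnS.
exists 1%N, 1%N, (fun=> Estable), (fun=> Ecenter), (fun=> Eunstable); split.
- by split.
- move=> _; split => //; rewrite mxdirectE /=.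
  by rewrite full rs ru rc mxrank1.
- split=> t x; have [k _ ->] := mderiv_qflow eta t x;
    have [e1 e2 e3] := jac_commute k (shear eta t (repr_pt x 0 ct));
    rewrite ?e1 ?e2 ?e3; apply: eqmxMfull; rewrite row_full_unit; exact: jac_unit.
- exists 1, (expR (- tau)); split => // [|x t tge0]; first exact: lam.
  rewrite mul1r expR_powR mulNr; split; first exact: opnorm_stable.
  exact: opnorm_unstable_inv.
- split; exists 4, (expR (- (tau / 2))); split => //; try (by apply: lam; lra).
  (* Dividing by an inverse leaves a product of two norms: linear growth on the center sum times the
     decay e^(- tau t). Half of the rate pays for the linear factor. *)
  + move=> x t tge0; rewrite invrK expR_powR.
    have T0 : 0 <= tau * t by rewrite mulr_ge0// ltW.
    rewrite (_ : - (tau / 2) * t = - (tau * t / 2)); last by field.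
    apply: le_trans (linear_le_expR T0); apply: ler_pM; rewrite ?opnorm_ge0//.
      exact: opnorm_center_stable.
    by have := opnorm_unstable eta (qflow eta t x) tge0; rewrite qflow_orbit_inv.
  + move=> x t tge0; rewrite invrK expR_powR.
    have T0 : 0 <= tau * t by rewrite mulr_ge0// ltW.
    rewrite (_ : - (tau / 2) * t = - (tau * t / 2)); last by field.
    apply: le_trans (linear_le_expR T0); rewrite mulrC.
    apply: ler_pM; rewrite ?opnorm_ge0//.
      by have := opnorm_center_unstable eta (qflow eta t x) tge0; rewrite qflow_orbit_inv.
    exact: opnorm_stable.
Qed.

End partial_hyperbolicity_of_qflow.

(** * Convergence of the fields *)

(** Neighbourhoods contain finite intersections of subbasic sets, so subbasic sets suffice to test
    convergence. *)
Lemma cvg_cinfty (R : realType) (m : nat) (M : manifold R m)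
    (F : set_system (vfield M)) (X : vfield M) : Filter F ->
  (forall B, cinfty_subbase B -> B X -> F B) -> F --> X.
Proof.
move=> FF hF A /=; rewrite (@nbhsE (vfield M)) => -[_ [[B sB <-] [C BC CX] sUBA]].
rewrite nbhs_filterE; apply: filterS sUBA _; apply: (@filterS _ _ _ C).
  by move=> ? ?; exists C.
have /sB [D sD IDeC] := BC; rewrite -IDeC; apply: filter_bigI => E DE.
have /sD := DE; rewrite inE => /hF; apply.
by move: CX; rewrite -IDeC => /(_ _ DE).
Qed.

Section qfield_convergence.
Context (R : realType).
Local Notation M := (qmanifold R).

Lemma qchart_img (p : 'rV[R]_4) : chart_img (qchart p) = cbox p.
Proof. exact: sect_img. Qed.

Lemma coord_fieldD (eta : R) :
  coord_field eta = coord_field 0 \+ (fun=> eta *: delta_mx 0 ct).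
Proof.
by apply/funext => p; rewrite /coord_field /= !vec4_sum !scale0r !addr0 !add0r.
Qed.

(** The perturbation eta d/dt is constant in every chart, so it is seen only at order zero. *)
Lemma iter_partial_qfield p q (eta : R) s : cbox p q ->
  iter_partial s (field_in_chart (qfield eta) (qchart p)) q =
  iter_partial s (field_in_chart (qfield 0) (qchart p)) q
  + if s is [::] then eta *: delta_mx 0 ct else 0.
Proof.
move=> pq; have near_box : \forall q' \near q, cbox p q'.
  by apply: open_nbhs_nbhs; split => //; exact: cbox_open.
have E e : iter_partial s (field_in_chart (qfield e) (qchart p)) q =
    iter_partial s (coord_field e) q.
  apply: (nbhs_singleton (near_eq_iter_partial _ _)).
  by apply: filterS near_box => q' pq'; rewrite field_in_qchart.
rewrite !E coord_fieldD iter_partialD ?iter_partial_cst//.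
  exact: coord_field_smooth.
exact: smooth_on_cst.
Qed.

Lemma qfield_cvg : qfield eta @[eta --> (0 : R)] --> qfield (0 : R).
Proof.
have FF : Filter (qfield eta @[eta --> (0 : R)]) by exact: fmap_filter.
apply: (cvg_cinfty FF) => _ [Z [_ [K [s [e [[p _ <-] cK Kp e0 ->]]]]]] ZX.
change (\forall eta \near (0 : R), cinfty_ball Z (qchart p) K s e (qfield eta)).
rewrite qchart_img in Kp.
case: s => [|i s] in ZX *; last first.
  by near=> eta => q Kq; rewrite iter_partial_qfield ?addr0; [exact: ZX|exact: Kp].
have [K0|/set0P K0] := eqVneq K set0.
  by near=> eta => q; rewrite K0.
(* The subbasic set is centered at some [Z], not at the limit field: its pointwise strict inequality
   becomes a uniform margin e - max f by compactness of [K]. *)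
pose f (q : 'rV[R]_4) : R := `|field_in_chart (qfield 0) (qchart p) q
   - field_in_chart Z (qchart p) q|.
have Hp : atlas (m := 4) (qchart p : chart R 4 M) by exists p.
have [|c] := EVT_max_rV (f := f) K0 cK.
  apply: continuous_in_subspaceT => q; rewrite inE => /Kp pq.
  have imgq : chart_img (qchart p) q by rewrite qchart_img.
  apply: continuous_comp; last exact: norm_continuous.
  apply: continuousB; apply: differentiable_continuous.
    exact: (vfield_smooth (qfield 0) Hp [::] imgq).
  exact: (vfield_smooth Z Hp [::] imgq).
rewrite inE => Kc fmax.
have d0 : 0 < e - f c by rewrite subr_gt0; exact: ZX.
have n0 : 0 < `|delta_mx 0 ct : 'rV[R]_4| + 1 by rewrite ltr_wpDl.
near=> eta => q Kq; rewrite iter_partial_qfield /=; last exact: Kp.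
rewrite addrAC (le_lt_trans (ler_normD _ _))// normrZ.
rewrite (@le_lt_trans _ _ (f c + `|eta| * (`|delta_mx 0 ct : 'rV[R]_4| + 1)))//.
  by rewrite lerD ?fmax ?inE// ler_wpM2l// lerDl.
rewrite -ltrBrDl -ltr_pdivlMr//; near: eta.
by apply: cvgr0_norm_lt; [exact: cvg_id|exact: divr_gt0].
Unshelve. all: by end_near. Qed.

End qfield_convergence.

(** * Entropy *)

Section entropy_bounds.
Context (R : realType) (T : topologicalType).
Implicit Types (f : T -> T) (U : set (set T)).

Lemma cover_number_le U (I : finType) (A : I -> set T) :
  (forall i, U (A i)) -> \bigcup_i A i = [set: T] ->
  cover_number R U <= #|I|%:R.
Proof.
move=> UA AT; apply: ge_inf; first by exists 0 => _ [n _ <-]; exact: ler0n.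
exists #|I| => //; exists (fun i => A (enum_val i)); split=> [i|]; first exact: UA.
rewrite -AT; apply/seteqP; split=> x [i _ Ax]; first by exists (enum_val i).
by exists (enum_rank i) => //; rewrite enum_rankK.
Qed.

(** The first hypothesis excludes the infimum of the empty set, whose value is 0. *)
Lemma cover_number_ge U (r : R) :
  (exists n (A : 'I_n -> set T), (forall i, U (A i)) /\ \bigcup_i A i = [set: T]) ->
  (forall n (A : 'I_n -> set T), (forall i, U (A i)) ->
    \bigcup_i A i = [set: T] -> r <= n%:R) ->
  r <= cover_number R U.
Proof.
move=> [n hn] h; apply: lb_le_inf; first by exists n%:R; exists n.
by move=> _ [k [A [UA AT]] <-]; exact: h UA AT.
Qed.

(** The constant disappears in the limit, because ln C / n tends to 0. *)
Lemma cover_entropy_le f U (C a : R) : 1 <= C -> 0 <= a ->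
  (forall n, (0 < n)%N -> cover_number R (cover_join f n U) <= C * expR (a * n%:R)) ->
  (cover_entropy R f U <= a%:E)%E.
Proof.
move=> C1 a0 h; have C0 : 0 < C by exact: lt_le_trans C1.
apply/lee_addgt0Pr => e e0; rewrite /cover_entropy /limn_esup limf_esupE.
pose N := (Num.truncn (ln C / e)).+1.
apply: (@le_trans _ _ (ereal_sup ((fun n =>
    (ln (cover_number R (cover_join f n U)) / n%:R)%:E) @` [set n | (N <= n)%N]))).
  by apply: ereal_inf_lbound; exists [set n | (N <= n)%N] => //; exists N.
apply: ge_ereal_sup => _ [n /= Nn <-]; rewrite -EFinD lee_fin.
have n0 : (0 < n)%N by exact: leq_trans Nn.
have n0R : 0 < n%:R :> R by rewrite ltr0n.
have lnC : ln C <= e * n%:R.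
  rewrite mulrC -ler_pdivrMr// ltW// (lt_le_trans (truncnS_gt _))//.
  by rewrite ler_nat.
rewrite ler_pdivrMr// mulrDl.
apply: (@le_trans _ _ (ln C + a * n%:R)); last by rewrite addrC lerD2l.
(* On nonpositive numbers [ln] takes the value 0. *)
have [c0|c0] := leP (cover_number R (cover_join f n U)) 0.
  by rewrite ln0// addr_ge0 ?ln_ge0// mulr_ge0.
rewrite -[X in _ + X]expRK -lnM ?posrE ?expR_gt0// ler_ln ?posrE ?mulr_gt0 ?expR_gt0//.
exact: h.
Qed.

Lemma cover_entropy_ge f U (a : R) :
  (forall n, (0 < n)%N -> expR (a * n%:R) <= cover_number R (cover_join f n U)) ->
  (a%:E <= cover_entropy R f U)%E.
Proof.
move=> h; rewrite /cover_entropy /limn_esup limf_esupE.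
apply: le_ereal_inf_tmp => _ [V [N _ NV] <-].
apply: le_ereal_sup_tmp.
exists (ln (cover_number R (cover_join f N.+1 U)) / N.+1%:R)%:E.
  by exists N.+1 => //; apply: NV => /=; exact: leqnSn.
have hN := h N.+1 isT.
rewrite lee_fin ler_pdivlMr ?ltr0n// -[leLHS]expRK ler_ln ?posrE ?expR_gt0//.
exact: lt_le_trans (expR_gt0 _) hN.
Qed.

Lemma iter_continuous f n : continuous f -> continuous (iter n f).
Proof.
move=> fc; elim: n => [|n ih] x /=; first exact: cvg_id.
by apply: continuous_comp; [exact: ih|exact: fc].
Qed.

Lemma cover_join_finite f n U : compact [set: T] -> continuous f -> open_cover U ->
  exists N (B : 'I_N -> set T), (forall i, cover_join f n U (B i)) /\
    \bigcup_i B i = [set: T].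
Proof.
move=> cT fc [Uo UT].
have pick x : {A | U A /\ A x}.
  by apply: cid; have : [set: T] x by []; rewrite -UT => -[A UA Ax]; exists A.
pose B x : set T := \bigcap_(i in [set: 'I_n]) (iter i f @^-1` sval (pick (iter i f x))).
have BJ x : cover_join f n U (B x).
  exists (fun i : 'I_n => sval (pick (iter i f x))); split=> // i.
  by have [] := svalP (pick (iter i f x)).
have Bo x : nbhs x (B x).
  have : \forall y \near x, forall i : 'I_n, sval (pick (iter i f x)) (iter i f y).
    apply: filter_forall => i; apply: (iter_continuous fc).
    have [UA Ax] := svalP (pick (iter i f x)).
    by apply: open_nbhs_nbhs; split => //; exact: Uo.
  by apply: filterS => y hy i _; exact: hy.
(* [compact_cover] is stated for pointed spaces only, hence the detour through
   near coverings and the filter of large finite sequences. *)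
pose F := filter_from setT (fun s : seq T => [set t : seq T | {subset s <= t}]).
have FF : Filter F.
  apply: filter_fromT_filter; first by exists [::].
  move=> s t; exists (s ++ t) => r /= h.
  by split=> x /= xs; apply: h; rewrite mem_cat xs ?orbT.
have [|s _ /(_ s) Hs] := (compact_near_coveringP _).1 cT _ F
    (fun s x => exists2 y, y \in s & B y x) FF.
  move=> x _; exists (B x, [set t : seq T | x \in t]) => /=.
    by split; [exact: Bo|exists [:: x] => // t; apply; rewrite mem_head].
  by move=> [y t] [/= Bxy xt]; exists x.
exists (size s), (fun i => B (tnth (in_tuple s) i)); split => //.
apply/seteqP; split => // x _; have [y ys By] := Hs (fun=> id) x I.
have yS : (index y s < size s)%N by rewrite index_mem.
exists (Ordinal yS) => //.
by rewrite (tnth_nth y)/= nth_index.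
Qed.

End entropy_bounds.

(** * Lower bound for the entropy of X_0 *)

Section entropy_of_qflow.
Context (R : realType).
Local Notation tau := (@tau R).
Local Notation M := (qmanifold R).
Implicit Types (p q : 'rV[R]_4) (U : set (set M)).

Lemma qflow_continuous eta t : continuous (qflow (R := R) eta t).
Proof.
apply/(quotient_continuous (qflow eta t)).2.
rewrite (_ : _ \o _ = @proj R \o coord_flow eta t); last first.
  by apply/funext => p; exact: qflow_proj.
move=> p; apply: continuous_comp; last exact: proj_continuous.
by have [/differentiable_continuous] := is_diff_coord_flow eta t p.
Qed.

Lemma iter_qflow eta n p :
  iter n (qflow eta 1) (proj p) = proj (coord_flow eta n%:R p).
Proof.
elim: n => [|n ih]; first by rewrite coord_flow0.
by rewrite iterS ih qflow_proj -coord_flowD nat1r.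
Qed.

(* Balls of the invariant metric, up to a factor: they are permuted by the deck
   transformations. *)
Definition abox (r : R) p : set 'rV[R]_4 := [set q |
  [/\ `|q 0 cx - p 0 cx| < r * expR (- p 0 cs),
      `|q 0 cy - p 0 cy| < r * expR (p 0 cs),
      `|q 0 cs - p 0 cs| < r & `|q 0 ct - p 0 ct| < r]].

Lemma abox_deck r k l u v p q :
  abox r p q -> abox r (deck k l u v p) (deck k l u v q).
Proof.
move=> [hx hy hs ht]; rewrite /abox /= !vec4E; split.
- rewrite (_ : _ - _ = (q 0 cx - p 0 cx) * expR (k%:~R * tau)); last by ring.
  rewrite normrM (gtr0_norm (expR_gt0 _)) opprB [k%:~R * tau - _]addrC expRD mulrA.
  by rewrite ltr_pM2r ?expR_gt0.
- rewrite (_ : _ - _ = (q 0 cy - p 0 cy) * expR (- (k%:~R * tau))); last by ring.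
  rewrite normrM (gtr0_norm (expR_gt0 _)) expRD mulrA.
  by rewrite ltr_pM2r ?expR_gt0.
- by rewrite (_ : _ - _ = q 0 cs - p 0 cs)//; ring.
- by rewrite (_ : _ - _ = q 0 ct - p 0 ct)//; ring.
Qed.

Lemma expR_small (r : R) : r <= 1 / 2 -> expR r <= 2.
Proof.
move=> r2; have h := expR_ge1Dx (- r); have e0 := expR_gt0 r.
have e1 : expR r * expR (- r) = 1 by rewrite -expRD subrr expR0.
nra.
Qed.

(** The unstable leaf of the origin, over the invariant circle t = 0. *)
Definition hpoint (x : R) : 'rV[R]_4 := vec4 x 0 0 0.

(** Lift both points to the same box: the lifts differ from [hpoint x] and [hpoint x'] by a deck
    transformation, which moves s too little to have k' <> 0 and, as 4r + 1/4 < 1/2, translates too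
    little to be a nonzero lattice vector. The box has half-width at most 2r in x. *)
Lemma hpoint_expansive r p x x' : 0 < r -> r <= 1 / 32 ->
  (@proj R @` abox r p) (proj (hpoint x)) ->
  (@proj R @` abox r p) (proj (hpoint x')) ->
  `|x - x'| <= 1 / 4 -> `|x - x'| < 4 * r.
Proof.
move=> r0 r1 [a pa /projP[k [l [u [v [uv Ea]]]]]] [b pb /esym/projP Eb] xx'.
have h1 := abox_deck k l u v pa; have h2 := abox_deck k l u v pb.
rewrite -Ea in h1.
have [k' [l' [u' [v' [uv' Eb']]]]] : orb (hpoint x') (deck k l u v b).
  exact: orb_trans Eb (orb_deck _ _ _ uv).
rewrite Eb' in h2; move: (deck k l u v p) h1 h2 => P.
rewrite /abox/= /hpoint !vec4E => -[gx gy gs _] [hx hy hs _].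
have tau2 := tau_ge_half R.
have k'0 : k' = 0.
  apply: (@intr_small _ k' tau (1 / 2)) => //.
  by move: hs gs; rewrite !ltr_norml => /andP[? ?] /andP[? ?]; apply/andP; split; lra.
move: hx hy; rewrite k'0 mulr0z !mul0r expR0 !mulr1 add0r => hx hy.
have Ps : `|P 0 cs| < r by move: gs; rewrite sub0r normrN.
have e1 : expR (- P 0 cs) <= 2.
  by apply: expR_small; move: Ps; rewrite ltr_norml => /andP[? ?]; lra.
have e2 : expR (P 0 cs) <= 2.
  by apply: expR_small; move: Ps; rewrite ltr_norml => /andP[? ?]; lra.
have re1 : r * expR (- P 0 cs) <= 2 * r by rewrite mulrC ler_pM2r.
have re2 : r * expR (P 0 cs) <= 2 * r by rewrite mulrC ler_pM2r.
have [u'0 _] : u' = 0 /\ v' = 0.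
  apply: lat_small uv' _ _.
    move: hx gx xx'; rewrite !ltr_norml ler_norml => /andP[? ?] /andP[? ?] /andP[? ?].
    by apply/andP; split; lra.
  move: hy gy; rewrite !ltr_norml => /andP[? ?] /andP[? ?].
  by apply/andP; split; lra.
move: hx gx; rewrite u'0 addr0 !ltr_norml => /andP[? ?] /andP[? ?].
by apply/andP; split; lra.
Qed.

(** The flow raises s by 3 tau n, which the deck transformation with k = 3n brings back to 0 at the
    cost of a factor e^(3 tau n) on x. *)
Lemma coord_flow_hpoint n x : proj (coord_flow 0 n%:R (hpoint x)) =
  proj (hpoint (x * expR (3 * tau * n%:R))) :> orbspace R.
Proof.
rewrite -(proj_deck (3 * n%:Z) 0 (coord_flow 0 n%:R (hpoint x)) (lat0 R)).
congr proj; rewrite /coord_flow /hpoint /deck !vec4E /drift eqxx /speed cos0.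
rewrite mulr0z intrM !mul0r !addr0 !add0r.
by congr vec4; [congr (_ * expR _); ring|ring].
Qed.

Lemma htop_qflow0_ge : ((3 * tau)%:E <= htop R (qflow (R := R) 0 1))%E.
Proof.
have tau0 := tau_gt0 R; set a := 3 * tau; have a0 : 0 < a by rewrite mulr_gt0.
(* Chosen so that 4 r e^a = 1/8: a distance below 4r is still within the range 1/4 of
   [hpoint_expansive] after one more iterate. *)
pose r := expR (- a) / 32.
have ea : expR (- a) <= 1 by rewrite expR_le1 oppr_le0 ltW.
have r0 : 0 < r by rewrite divr_gt0 ?expR_gt0.
have r1 : r <= 1 / 32 by rewrite ler_pM2r.
pose U := range (fun p => @proj R @` ball p (r * expR (- `|p 0 cs|))).
have Ucover : open_cover U.
  split=> [_ [p _ <-]|]; first by apply: proj_open; exact: ball_open.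
  apply/seteqP; split => // x _.
  exists (@proj R @` ball (repr_pt x) (r * expR (- `|repr_pt x 0 cs|))).
    by exists (repr_pt x).
  exists (repr_pt x); last exact: repr_ptK.
  by apply: ballxx; rewrite mulr_gt0 ?expR_gt0.
have Uabox A : U A -> exists p, A `<=` @proj R @` abox r p.
  move=> [p _ <-]; exists p => _ [q pq <-]; exists q => //.
  have le1 : r * expR (- `|p 0 cs|) <= r * expR (- p 0 cs).
    by rewrite ler_pM2l// ler_expR lerN2 ler_norm.
  have le2 : r * expR (- `|p 0 cs|) <= r * expR (p 0 cs).
    by rewrite ler_pM2l// ler_expR lerNl -normrN ler_norm.
  have le3 : r * expR (- `|p 0 cs|) <= r.
    by rewrite ger_pMr// expR_le1 oppr_le0.
  move: pq => /ball4P[hx hy hs ht]; split; rewrite distrC.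
  - exact: lt_le_trans hx le1.
  - exact: lt_le_trans hy le2.
  - exact: lt_le_trans hs le3.
  - exact: lt_le_trans ht le3.
apply: (@le_trans _ _ (cover_entropy R (qflow (R := R) 0 1) U)); last first.
  by apply: ereal_sup_ubound; exists U.
apply: cover_entropy_ge => n n0.
apply: cover_number_ge.
  by apply: cover_join_finite => //; [exact: orbspace_compact|exact: qflow_continuous].
move=> m A AJ AT.
(* Bootstrap over the iterates: a distance of at most 1/4 at time i is in fact below 4r, hence below
   1/8 at time i + 1. Two points of one element of the join are thus less than e^(- a n) / 8
   apart. *)
have sep j x x' : A j (proj (hpoint x)) -> A j (proj (hpoint x')) ->
    `|x - x'| <= 1 / 4 -> `|x - x'| * expR (a * n%:R) < 1 / 8.
  have [B [BU ->]] := AJ j => hx hx' xx'.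
  have step i : (i < n)%N -> `|x - x'| * expR (a * i%:R) <= 1 / 4 ->
      `|x - x'| * expR (a * i%:R) < 4 * r.
    move=> lin; have [p Bp] := Uabox _ (BU (Ordinal lin)).
    have /= := hx (Ordinal lin) I; rewrite iter_qflow coord_flow_hpoint => /Bp h1.
    have /= := hx' (Ordinal lin) I; rewrite iter_qflow coord_flow_hpoint => /Bp h2.
    have := hpoint_expansive r0 r1 h1 h2.
    by rewrite -mulrBl normrM (gtr0_norm (expR_gt0 _)).
  have r4 : 4 * r * expR a = 1 / 8.
    have : expR (- a) * expR a = 1 by rewrite -expRD addNr expR0.
    by rewrite /r; lra.
  have small i : (i <= n)%N -> `|x - x'| * expR (a * i%:R) <= 1 / 4.
    elim: i => [_|i ih lin]; first by rewrite mulr0 expR0 mulr1.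
    rewrite -natr1 mulrDr mulr1 expRD mulrA.
    have := step i lin (ih (ltnW lin)); have := expR_gt0 a; nra.
  have nn : n = n.-1.+1 by rewrite prednK.
  have h := step n.-1 (etrans (ltn_predL n) n0) (small _ (leq_pred n)).
  rewrite {1}nn -natr1 mulrDr mulr1 expRD mulrA -r4.
  by rewrite ltr_pM2r// expR_gt0.
pose N := (Num.truncn (expR (a * n%:R))).+1.
apply: (@le_trans _ _ N%:R); first by rewrite ltW// truncnS_gt.
rewrite ler_nat.
(* More than e^(a n) points on a segment of length at most 1/4, with spacing e^(- a n) / 4: no two
   of them share an element of the join. *)
pose z (i : 'I_N) : R := i%:R * (expR (- (a * n%:R)) / 4).
have E1 : expR (- (a * n%:R)) * expR (a * n%:R) = 1 by rewrite -expRD addNr expR0.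
have zdist (i j : 'I_N) : `|z i - z j| = `|i%:R - j%:R| * (expR (- (a * n%:R)) / 4).
  by rewrite -mulrBl normrM [X in _ * X]gtr0_norm// divr_gt0 ?expR_gt0.
have zle (i j : 'I_N) : `|z i - z j| <= 1 / 4.
  have bnd (i' : 'I_N) : 0 <= (i'%:R : R) <= expR (a * n%:R).
    rewrite ler0n/= -truncn_ge_nat ?expR_ge0//.
    by rewrite -ltnS; exact: ltn_ord.
  have le_ij : `|(i%:R - j%:R : R)| <= expR (a * n%:R).
    have /andP[? ?] := bnd i; have /andP[? ?] := bnd j.
    by rewrite ler_norml; apply/andP; split; lra.
  have e4 : 0 <= expR (- (a * n%:R)) / 4 by rewrite divr_ge0 ?expR_ge0.
  by rewrite zdist; have := ler_wpM2r e4 le_ij; lra.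
have f_ i : {j : 'I_m | A j (proj (hpoint (z i)))}.
  apply: cid; have : [set: M] (proj (hpoint (z i))) by [].
  by rewrite -AT => -[j _ h]; exists j.
pose f i := sval (f_ i).
have f_inj : injective f.
  move=> i j fij; apply/val_inj/eqP; apply/negPn/negP => ij.
  have hj : A (f i) (proj (hpoint (z j))) by rewrite fij; exact: (svalP (f_ j)).
  have := sep (f i) _ _ (svalP (f_ i)) hj (zle i j).
  apply/negP; rewrite -leNgt zdist -mulrA.
  have -> : expR (- (a * n%:R)) / 4 * expR (a * n%:R) = 1 / 4.
    by rewrite mulrAC E1.
  have : 1 <= `|(i%:R - j%:R : R)|.
    move: ij; rewrite neq_ltn => /orP[lt|lt].
      by rewrite distrC ger0_norm ?subr_ge0 ?ler_nat 1?ltnW// lerBrDl natr1 ler_nat.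
    by rewrite ger0_norm ?subr_ge0 ?ler_nat 1?ltnW// lerBrDl natr1 ler_nat.
  lra.
by have := leq_card f f_inj; rewrite !card_ord.
Qed.

End entropy_of_qflow.

(** * Upper bound for the entropy of X_eta, eta <> 0 *)

Section entropy_upper_bound.
Context (R : realType).
Local Notation tau := (@tau R).
Local Notation M := (qmanifold R).
Implicit Types (p q : 'rV[R]_4) (U : set (set M)).

Lemma expR_ge1 (z : R) : (1 <= expR z) = (0 <= z).
Proof. by rewrite -expR0 ler_expR. Qed.

(** A Lebesgue number for the cover. Compactness gives it for centers in [fund_box], and the deck
    transformations, which permute the boxes, carry it to all centers. *)
Lemma lebesgue_abox U : open_cover U -> exists2 d : R, 0 < d &
  forall p, exists2 A, U A & forall q, abox d p q -> A (proj q).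
Proof.
move=> [Uo UT].
pose P (d : R) p := exists2 A, U A & forall q, abox d p q -> A (proj q).
have H : \forall d \near 0^'+, @fund_box R `<=` P d.
  apply: ((compact_near_coveringP _).1 (@fund_box_compact R) R _ P) => p _.
  have [A UA Ap] : exists2 A, U A & A (proj p).
    by have : [set: M] (proj p) by []; rewrite -UT => -[A UA Ap]; exists A.
  have : nbhs p (@proj R @^-1` A).
    by apply: proj_continuous; apply: open_nbhs_nbhs; split => //; exact: Uo.
  move=> /nbhs_ballP[e /= e0 He].
  (* Bounds e^s' and e^(- s') for all centers p' near p, so that a box of size d < e / (2 c) lies
     within e / 2 of its center. *)
  pose c := expR (`|p 0 cs| + e); have c0 : 0 < c := expR_gt0 _.
  have c1 : 1 <= c by rewrite expR_ge1 addr_ge0// ltW.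
  exists (ball p (e / 2), [set d : R | d < e / 2 / c]).
    split; first by apply: nbhsx_ballx; rewrite divr_gt0.
    apply: nbhs_right_lt; by rewrite !divr_gt0.
  move=> [p' d] /= [/ball4P[px py ps pt] dlt]; exists A => // q [qx qy qs qt].
  have dc : d * c < e / 2 by rewrite -ltr_pdivlMr.
  have d0 : 0 < d by exact: le_lt_trans (normr_ge0 _) qs.
  have de : d < e / 2 by apply: le_lt_trans dc; rewrite ler_peMr// ltW.
  have s'le : `|p' 0 cs| <= `|p 0 cs| + e.
    rewrite -(subrK (p 0 cs) (p' 0 cs)) addrC (le_trans (ler_normD _ _))// lerD2l.
    by rewrite distrC ltW// (lt_trans ps)//; lra.
  have b1 : d * expR (- p' 0 cs) < e / 2.
    apply: le_lt_trans dc; rewrite ler_pM2l// ler_expR (le_trans _ s'le)//.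
    by rewrite -normrN ler_norm.
  have b2 : d * expR (p' 0 cs) < e / 2.
    by apply: le_lt_trans dc; rewrite ler_pM2l// ler_expR (le_trans _ s'le)// ler_norm.
  apply: He; apply/ball4P.
  have tri (a b c' : R) : `|a - b| < e / 2 -> `|c' - b| < e / 2 -> `|a - c'| < e.
    by rewrite !ltr_norml => /andP[? ?] /andP[? ?]; apply/andP; split; lra.
  split.
  - exact: tri px (lt_trans qx b1).
  - exact: tri py (lt_trans qy b2).
  - exact: tri ps (lt_trans qs de).
  - exact: tri pt (lt_trans qt de).
have [d [d0 Hd]] : exists d : R, 0 < d /\ @fund_box R `<=` P d.
  have : \forall d \near 0^'+, 0 < d /\ @fund_box R `<=` P d.
    by near=> d; split; [near: d; exact: nbhs_right_gt|near: d].
  by move=> /filter_ex[d]; exists d.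
exists d => // p; have [q Kq [k [l [u [v [uv E]]]]]] := orb_fund_box p.
have [A UA HA] := Hd q Kq; exists A => // q' /(abox_deck k l u v).
by rewrite -E => /HA; rewrite proj_deck.
Unshelve. all: by end_near. Qed.

(* Shrinking the unstable side of a box by e^(- 2 tau n - c) keeps its first n
   images small. *)
Lemma coord_flow_abox eta (n : nat) (d : R) p q : eta != 0 -> 0 < d ->
  0 <= p 0 cs <= tau -> let c := 2 * tau / `|eta| in
  `|q 0 cx - p 0 cx| < d * expR (- (tau + c + 2 * tau * n%:R)) ->
  `|q 0 cy - p 0 cy| < d -> `|q 0 cs - p 0 cs| < d / (1 + c) ->
  `|q 0 ct - p 0 ct| < d / (1 + c) ->
  forall i, (i < n)%N -> abox d (coord_flow eta i%:R p) (coord_flow eta i%:R q).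
Proof.
move=> e0 d0 /andP[s0 s1] c qx qy qs qt i lin; have t0 := tau_gt0 R.
have c0 : 0 <= c by rewrite divr_ge0// mulr_ge0// ltW.
have i0 : 0 <= i%:R :> R by [].
have in_ : i%:R <= n%:R :> R by rewrite ler_nat ltnW.
have D1 := drift_ge eta (p 0 ct) i0.
have D2 := drift_le i%:R (p 0 ct) e0.
have ti : 0 <= tau * i%:R by rewrite mulr_ge0// ltW.
have tn : 2 * tau * i%:R <= 2 * tau * n%:R by rewrite ler_wpM2l// mulr_ge0// ltW.
have dc : d / (1 + c) * (1 + c) = d by rewrite divfK// gt_eqF//; lra.
rewrite /abox /= /coord_flow !vec4E; split.
- apply: lt_le_trans qx _; rewrite ler_pM2l// ler_expR lerN2; rewrite -/c in D2; lra.
- by apply: lt_le_trans qy _; rewrite ler_peMr ?(ltW d0)// expR_ge1; lra.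
(* The difference in angle adds at most c times itself to the difference in s, uniformly in time;
   this is why both start below d / (1 + c). *)
- have h := drift_lipschitz i%:R (q 0 ct) (p 0 ct) e0; rewrite -/c in h.
  have h2 := ler_wpM2l c0 (ltW qt).
  rewrite opprD addrACA (le_lt_trans (ler_normD _ _))//.
  by rewrite -dc mulrDr mulr1; rewrite mulrC in h2; lra.
- rewrite opprD addrACA subrr addr0 (lt_le_trans qt)//.
  by rewrite ler_pdivrMr ?ler_peMr ?(ltW d0)//; lra.
Qed.

Lemma grid_approx (L r z : R) : 0 < r -> 0 <= z <= L ->
  exists i : 'I_(Num.truncn (L / r)).+1, `|z - i%:R * r| < r /\ i%:R * r <= L.
Proof.
move=> r0 /andP[z0 zL]; have zr : 0 <= z / r by rewrite divr_ge0// ltW.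
have /andP[h1 h2] := truncn_itv zr.
have hi : (Num.truncn (z / r) < (Num.truncn (L / r)).+1)%N.
  by rewrite ltnS le_truncn// ler_pM2r// invr_gt0.
exists (Ordinal hi) => /=.
move: h1 h2; rewrite ler_pdivlMr// ltr_pdivrMr// -natr1 mulrDl mul1r => h1 h2.
by split; [rewrite ltr_norml; apply/andP; split; lra|exact: le_trans zL].
Qed.

(** A grid on [fund_box] whose cells follow a single itinerary for n steps. Only the mesh in x
    depends on n, so the number of cells grows like e^(2 tau n). *)
Lemma htop_qflow_le eta : eta != 0 ->
  (htop R (qflow (R := R) eta 1) <= (2 * tau)%:E)%E.
Proof.
move=> e0; have t0 := tau_gt0 R; apply: ge_ereal_sup => _ [U Ucov <-].
have [d d0 Hd] := lebesgue_abox Ucov.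
pose c := 2 * tau / `|eta|.
have c0 : 0 <= c by rewrite divr_ge0// mulr_ge0// ltW.
pose e := d / (1 + c).
have epos : 0 < e by rewrite divr_gt0//; lra.
pose r n := d * expR (- (tau + c + 2 * tau * n%:R)).
have rpos n : 0 < r n by rewrite mulr_gt0 ?expR_gt0.
pose Ny := (Num.truncn (6 / d)).+1.
pose Ns := (Num.truncn (tau / e)).+1.
pose Nt := (Num.truncn (pi *+ 2 / e)).+1.
(* The interval [-3, 3] has length 6; the final 1 covers the rounding up in the number of cells. *)
pose C0 := 6 / d * expR (tau + c) + 1.
have C0ge : 1 <= C0 by rewrite lerDr mulr_ge0 ?expR_ge0// divr_ge0// ltW.
have Ege n : 1 <= expR (2 * tau * n%:R) by rewrite expR_ge1 !mulr_ge0// ltW.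
have Nx_le n : (Num.truncn (6 / r n)).+1%:R <= C0 * expR (2 * tau * n%:R).
  rewrite -[leLHS]natr1 /C0 [leRHS]mulrDl mul1r lerD//.
  have -> : 6 / d * expR (tau + c) * expR (2 * tau * n%:R) = 6 / r n.
    rewrite -mulrA -expRD /r invfM expRN invrK mulrA; congr (_ * expR _); ring.
  by rewrite truncn_le divr_ge0// ltW.
apply: (@cover_entropy_le _ _ _ _ (C0 * (Ny * Ns * Nt)%:R)).
- by rewrite mulr_ege1// ler1n.
- by rewrite mulr_ge0// ltW.
move=> n _; pose Nx := (Num.truncn (6 / r n)).+1.
pose ctr (i : 'I_Nx * 'I_Ny * 'I_Ns * 'I_Nt) : 'rV[R]_4 :=
  vec4 (-3 + i.1.1.1%:R * r n) (-3 + i.1.1.2%:R * d) (i.1.2%:R * e) (i.2%:R * e).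
pose sel p := projT1 (cid2 (Hd p)).
have selU p : U (sel p) by rewrite /sel; case: cid2.
have selP p q : abox d p q -> sel p (proj q) by rewrite /sel; case: cid2 => A /= _ h /h.
pose B i : set M := \bigcap_(j in [set: 'I_n])
  (iter j (qflow eta 1) @^-1` sel (coord_flow eta j%:R (ctr i))).
have BJ i : cover_join (qflow eta 1) n U (B i).
  by exists (fun j : 'I_n => sel (coord_flow eta j%:R (ctr i))).
apply: (@le_trans _ _ (#|{: 'I_Nx * 'I_Ny * 'I_Ns * 'I_Nt}|%:R)); last first.
  rewrite !card_prod !card_ord -!mulnA !natrM mulrAC ler_wpM2r//.
  exact: Nx_le.
apply: (@cover_number_le R _ _ _ B BJ).
apply/seteqP; split => // x _.
have [q [qx qy qs qt] xq] := orb_fund_box (repr_pt x).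
have [|i1 [h1 _]] := @grid_approx 6 (r n) (q 0 cx + 3) (rpos n).
  by move: qx => /andP[? ?]; apply/andP; split; lra.
have [|i2 [h2 _]] := @grid_approx 6 d (q 0 cy + 3) d0.
  by move: qy => /andP[? ?]; apply/andP; split; lra.
have [i3 [h3 i3le]] := grid_approx epos qs.
have [i4 [h4 _]] := grid_approx epos qt.
exists (i1, i2, i3, i4) => // j _.
have xE : x = proj q by rewrite -(repr_ptK x); exact/projP.
rewrite /= xE iter_qflow; apply: selP.
have sctr : ctr (i1, i2, i3, i4) 0 cs = i3%:R * e by rewrite /ctr vec4E.
apply: (coord_flow_abox (n := n) e0 d0) => //; rewrite ?sctr /ctr ?vec4E.
- by rewrite i3le mulr_ge0// ltW.
- by rewrite opprD opprK addrA.
- by rewrite opprD opprK addrA.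
- exact: h3.
- exact: h4.
Qed.

End entropy_upper_bound.

Theorem theorem3 (R : realType) :
  exists (m : nat) (M : manifold R m) (g : riemannian_metric M)
         (X0 : vfield M),
    [/\ compact [set: M],
        ph_fields g 2 X0
      & ~ lower_semicontinuous_at (ph_fields g 2) (@htop_flow R m M) X0].
Proof.
exists 4%N, (qmanifold R), (qmetric R), (qfield 0); split.
- exact: orbspace_compact.
- exact: qfield_ph.
move=> lsc; have t0 := tau_gt0 R.
have htopE eta : htop_flow (qfield (R := R) eta) = htop R (qflow eta 1).
  by rewrite /htop_flow flow_qfield.
(* The level 2 tau lies strictly below the entropy of X_0 and is never exceeded by X_eta with eta <>
   0. *)
have /lsc : ((2 * tau R)%:E < htop_flow (qfield (R := R) 0))%E.
  rewrite htopE; apply: lt_le_trans (htop_qflow0_ge R).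
  by rewrite lte_fin ltr_pM2r//; lra.
rewrite /within/= => near0.
have near_eta : \forall eta \near (0 : R), ph_fields (qmetric R) 2 (qfield eta) ->
    ((2 * tau R)%:E < htop_flow (qfield (R := R) eta))%E.
  exact: (@qfield_cvg R _ near0).
have [e /= e0 He] := (nbhs_ballP _ _).1 near_eta.
have e2 : e / 2 != 0 by rewrite gt_eqF// divr_gt0.
have e2_ball : ball (0 : R) e (e / 2).
  by rewrite /ball/= sub0r normrN gtr0_norm ?divr_gt0//; lra.
by have := He _ e2_ball (qfield_ph _); rewrite htopE ltNge htop_qflow_le.
Qed.
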